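(* Fix an integer $k_{IJ}\ge0$. Suppose that for each $0\le k\le k_{IJ}+1$ the random functions $\theta\mapsto d_\theta^kg_n(\theta)$, $n\ge1$, on $\Omega_\theta$ are independent and identically distributed with $\mathbb{E}\big[\|d_\theta^kg_n(\theta)\|_2^2\big]<\infty$ for $\theta\in\Omega_\theta$, and that $\gamma_n^{(k)}:=\sup_{\theta\in\Omega_\theta}\|d_\theta^kg_n(\theta)\|_\infty<\infty$ for all $n\ge1$. Let $N_{loo}$ be a fixed positive integer not depending on $N$. For each $N$ let $\mathscr{N}\subseteq\{1,\dots,N\}$ be a set of $N_{loo}$ indices chosen at random according to any distribution that is independent of the functions $g_0,\dots,g_N$, and let $\mathscr{W}_{loo}:=\{w_{(-n)}:n\in\mathscr{N}\}$, where $w_{(-n)}\in\mathbb{R}^N$ is $0$ in its $n$-th entry and $1$ otherwise. Suppose that the following hold for all $N$ and all $w\in\mathscr{W}_{loo}$, with constants that do not depend on $N$: (1) for each $\tilde w\in\Omega_w$ there is a solution $\hat\theta(\tilde w)$ of $G(\hat\theta(\tilde w),\tilde w)=0$ (one being fixed for each $\tilde w$), and the open set $\Omega_\theta\subseteq\mathbb{R}^D$ contains, for some $\epsilon>0$, every point at Euclidean distance less than $\epsilon$ from the convex hull of $\{\hat\theta(\tilde w):\tilde w\in\Omega_w\}$; (2) $g_0,\dots,g_N$ are $k_{IJ}+1$ times continuously differentiable on $\Omega_\theta$; (3) $H(\theta,1_N)$ is symmetric positive definite for all $\theta\in\Omega_\theta$ and $\sup_{\theta\in\Omega_\theta}\|H(\theta,1_N)^{-1}\|_{op}\le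 C_{op}<\infty$; (4) $\sup_{\theta\in\Omega_\theta}\|d_\theta^kG(\theta,1_N)\|_2\le M_k<\infty$ for $1\le k\le k_{IJ}+1$. Then for every $\eta>0$ there is a constant $C_\eta<\infty$, not depending on $N$, such that for all sufficiently large $N$, with probability at least $1-\eta$, $$\max_{w\in\mathscr{W}_{loo}}\big\|\hat\theta^{IJ}_{k_{IJ}}(w)-\hat\theta(w)\big\|_2\le C_\eta\,N^{-(k_{IJ}+1)}.$$
   Context: $g_0,g_1,g_2,\dots$ are (random) functions of $\theta\in\mathbb{R}^D$ with values in $\mathbb{R}^D$, defined at least on the open set $\Omega_\theta$; probability statements refer to the randomness of the functions $g_n$ and of the indices $\mathscr{N}$. For each $N$ and $w\in\mathbb{R}^N$, $G(\theta,w):=\frac1N\big(g_0(\theta)+\sum_{n=1}^Nw_ng_n(\theta)\big)$. $1_N$ is the all-ones vector of length $N$. $d_\theta^kG(\theta,w)$ and $d_\theta^kg_n(\theta)$ are the arrays of all partial derivatives of order $k$ in $\theta$ ($d_\theta^0G=G$, $d_\theta^0g_n=g_n$), and $H(\theta,w):=d_\theta^1G(\theta,w)$. $\|\cdot\|_2$ and $\|\cdot\|_\infty$ of an array are the Euclidean and max norms of its vectorization; $\|\cdot\|_{op}$ is the matrix operator norm. For a given $w\in\mathbb{R}^N$ and an arbitrarily small scalar $\varepsilon>0$ (which may depend on $N$), $\Omega_w:=\{\tilde w\in\mathbb{R}^N:\|\tilde w-((1-t)1_N+tw)\|_2<\varepsilon\text{ for some }t\in[0,1]\}$. Write $\hat\theta:=\hat\theta(1_N)$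 and $\Delta w:=w-1_N$. Let $\delta_w^k\hat\theta(1_N):=\sum_{n_1,\dots,n_k}\frac{\partial^k\hat\theta(w')}{\partial w'_{n_1}\cdots\partial w'_{n_k}}\big|_{w'=1_N}\Delta w_{n_1}\cdots\Delta w_{n_k}$, where the derivatives at $1_N$ are those of the locally unique solution branch of $G(\theta,w')=0$ through $(\hat\theta,1_N)$ (implicit function theorem; $H(\hat\theta,1_N)$ is invertible). The $k_{IJ}$-th order infinitesimal jackknife is $\hat\theta^{IJ}_{k_{IJ}}(w):=\hat\theta+\sum_{k=1}^{k_{IJ}}\frac1{k!}\delta_w^k\hat\theta(1_N)$, with $\hat\theta^{IJ}_0(w)=\hat\theta$. The set $\Omega_\theta$ does not depend on $N$. *)

(* Defs.v *)
From HB Require Import structures.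
From mathcomp Require Import all_boot all_order all_algebra.
From mathcomp Require Import all_classical all_reals all_analysis.
Import Order.TTheory GRing.Theory Num.Theory.
Import numFieldNormedType.Exports.

Set Implicit Arguments.
Unset Strict Implicit.
Unset Printing Implicit Defensive.

Local Open Scope classical_set_scope.
Local Open Scope ring_scope.

(** Norms.  An array is a family over a finite index type; the library norm
    [`|x|] on ['rV[R]_n] is the max norm, hence a separate Euclidean norm. *)

Definition l2norm (R : realType) (I : finType) (x : I -> R) : R :=
  Num.sqrt (\sum_i x i ^+ 2).

Definition linfnorm (R : realType) (I : finType) (x : I -> R) : R :=
  \big[Num.max/0]_i `|x i|.

Definition enorm (R : realType) (n : nat) (v : 'rV[R]_n) : R :=
  l2norm (fun i => v 0 i).

Definition opnorm (R : realType) (n : nat) (A : 'M[R]_n) : R :=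
  sup [set enorm (A *m x^T)^T | x in [set x : 'rV[R]_n | enorm x <= 1]].

Definition sym_posdef (R : realType) (n : nat) (A : 'M[R]_n) : Prop :=
  A^T = A /\ forall x : 'rV[R]_n, x != 0 -> 0 < (x *m A *m x^T) 0 0.

Definition sup_on (R : realType) (U : Type) (A : set U) (f : U -> R) : \bar R :=
  ereal_sup [set (f x)%:E | x in A].

(** Partial derivatives. *)

(* [pderiv [:: i1; ...; ik] f] is the iterated partial derivative
   d/dx_i1 ( ... (d/dx_ik f)). *)
Definition pderiv (R : realType) (m : nat) (V : normedModType R)
    (s : seq 'I_m) (f : 'rV[R]_m -> V) : 'rV[R]_m -> V :=
  foldr (fun i h x => 'D_(delta_mx 0 i) h x) f s.

Definition Cn_on (R : realType) (m : nat) (V : normedModType R) (k : nat)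
    (Omega : set 'rV[R]_m) (f : 'rV[R]_m -> V) : Prop :=
  (forall (s : seq 'I_m) (i : 'I_m), (size s < k)%N ->
     forall x, Omega x -> derivable (pderiv s f) x (delta_mx 0 i)) /\
  (forall s : seq 'I_m, (size s <= k)%N ->
     forall x, Omega x -> {for x, continuous (pderiv s f)}).

(* Entries of the array of all order-k derivatives of a map R^D -> R^D:
   k differentiation directions and one output coordinate. *)
Definition darray_index (D k : nat) : finType := (k.-tuple 'I_D * 'I_D)%type.

Definition darray (R : realType) (D k : nat) (f : 'rV[R]_D -> 'rV[R]_D)
    (theta : 'rV[R]_D) : darray_index D k -> R :=
  fun a => pderiv a.1 f theta 0 a.2.
Arguments darray {R D} k f theta.

(** Random functions.  A random function on [Omega] is a map
    [X : T -> ('rV_D -> A -> R)], [A] indexing the entries of its values.  Its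
    events are preimages of the product sigma-algebra, which is generated by
    the evaluations at the points of [Omega]; values outside [Omega] do not
    matter. *)

Definition cylinders (R : realType) (D : nat) (Omega : set 'rV[R]_D) (A : Type) :
    set (set ('rV[R]_D -> A -> R)) :=
  [set E | exists theta a (B : set R),
    [/\ Omega theta, measurable B & E = [set f | B (f theta a)]]].

Definition product_events (R : realType) (D : nat) (Omega : set 'rV[R]_D)
    (A : Type) : set (set ('rV[R]_D -> A -> R)) :=
  <<s @cylinders R D Omega A >>.

Definition random_function (R : realType) (d : measure_display)
    (T : measurableType d) (D : nat) (Omega : set 'rV[R]_D) (A : Type)
    (X : T -> 'rV[R]_D -> A -> R) : Prop :=
  forall E, product_events Omega E -> measurable (X @^-1` E).

Definition iid_random_functions (R : realType) (d : measure_display)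
    (T : measurableType d) (P : probability T R) (D : nat)
    (Omega : set 'rV[R]_D) (A : Type)
    (X : nat -> T -> 'rV[R]_D -> A -> R) : Prop :=
  [/\ forall n, random_function Omega (X n),
      forall (J : seq nat) (E : nat -> set ('rV[R]_D -> A -> R)), uniq J ->
        (forall j, product_events Omega (E j)) ->
        P [set x | forall j, j \in J -> E j (X j x)]
          = (\prod_(j <- J) P (X j @^-1` E j))%E
    & forall i j E, product_events Omega E ->
        P (X i @^-1` E) = P (X j @^-1` E)].

Definition indep_of_random_function (R : realType) (d : measure_display)
    (T : measurableType d) (P : probability T R) (D : nat)
    (Omega : set 'rV[R]_D) (A : Type) (F : finType)
    (Y : T -> F) (X : T -> 'rV[R]_D -> A -> R) : Prop :=
  forall (S : set F) E, product_events Omega E ->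
    P (Y @^-1` S `&` X @^-1` E) = (P (Y @^-1` S) * P (X @^-1` E))%E.

(* The event [A] itself need not be measurable. *)
Definition with_prob_ge (R : realType) (d : measure_display)
    (T : measurableType d) (P : probability T R) (p : R) (A : set T) : Prop :=
  exists E : set T, [/\ measurable E, E `<=` A & (p%:E <= P E)%E].

(** Weighted estimating equations. *)

(* The index [n : 'I_N] stands for observation n+1. *)
Definition estG (R : realType) (D N : nat) (g : nat -> 'rV[R]_D -> 'rV[R]_D)
    (theta : 'rV[R]_D) (w : 'rV[R]_N) : 'rV[R]_D :=
  N%:R^-1 *: (g 0%N theta + \sum_(n < N) w 0 n *: g n.+1 theta).

Definition hessian (R : realType) (D N : nat)
    (G : 'rV[R]_D -> 'rV[R]_N -> 'rV[R]_D)
    (theta : 'rV[R]_D) (w : 'rV[R]_N) : 'M[R]_D :=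
  \matrix_(i, j) darray 1 (G ^~ w) theta ([tuple j], i).

Definition ones (R : realType) (N : nat) : 'rV[R]_N := const_mx 1.

Definition wloo (R : realType) (N : nat) (n : 'I_N) : 'rV[R]_N :=
  \row_j (j != n)%:R.

Definition Wloo (R : realType) (N : nat) (A : {set 'I_N}) : seq 'rV[R]_N :=
  [seq wloo R n | n <- enum A].

Definition Omega_w (R : realType) (N : nat) (eps : R) (w : 'rV[R]_N) :
    set 'rV[R]_N :=
  [set w' | exists t : R, 0 <= t <= 1 /\
     enorm (w' - ((1 - t) *: ones R N + t *: w)) < eps].

Definition conv_hull (R : realType) (D : nat) (A : set 'rV[R]_D) :
    set 'rV[R]_D :=
  smallest (fun B : set 'rV[R]_D => convex_set B) A.

(** Infinitesimal jackknife. *)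

Definition solution_branch (R : realType) (D N : nat)
    (G : 'rV[R]_D -> 'rV[R]_N -> 'rV[R]_D)
    (theta0 : 'rV[R]_D) (w0 : 'rV[R]_N) : set ('rV[R]_N -> 'rV[R]_D) :=
  [set phi | phi w0 = theta0 /\
     \forall w \near w0, G (phi w) w = 0 /\ {for w, continuous phi}].

(* When the Jacobian of G in theta is continuous and invertible at
   (theta0, w0), the implicit function theorem says that a branch exists and
   that two branches agree near w0, so that the derivatives at w0 do not depend
   on the choice made here.  Otherwise the value may be meaningless. *)
Definition local_solution (R : realType) (D N : nat)
    (G : 'rV[R]_D -> 'rV[R]_N -> 'rV[R]_D)
    (theta0 : 'rV[R]_D) (w0 : 'rV[R]_N) : 'rV[R]_N -> 'rV[R]_D :=
  xget (fun=> theta0) (solution_branch G theta0 w0).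

Definition delta_w (R : realType) (D N : nat)
    (phi : 'rV[R]_N -> 'rV[R]_D) (k : nat) (w : 'rV[R]_N) : 'rV[R]_D :=
  \sum_(s : k.-tuple 'I_N)
    (\prod_(n <- s) (w - ones R N) 0 n) *: pderiv s phi (ones R N).

Definition theta_IJ (R : realType) (D N : nat)
    (G : 'rV[R]_D -> 'rV[R]_N -> 'rV[R]_D) (theta0 : 'rV[R]_D)
    (kIJ : nat) (w : 'rV[R]_N) : 'rV[R]_D :=
  theta0 + \sum_(1 <= k < kIJ.+1)
    (k`!%:R)^-1 *: delta_w (local_solution G theta0 (ones R N)) k w.

(* Main.v *)
Require Import Defs.
From HB Require Import structures.
From mathcomp Require Import all_boot all_order all_algebra.
From mathcomp Require Import all_classical all_reals all_analysis.
From mathcomp Require Import measurable_realfun.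
From mathcomp Require Import ring.
Import Order.TTheory GRing.Theory Num.Theory.
Import numFieldNormedType.Exports.

Set Implicit Arguments.
Unset Strict Implicit.
Unset Printing Implicit Defensive.

Local Open Scope classical_set_scope.
Local Open Scope ring_scope.

(** Removing the fraction [t] of observation [n] turns the equation
    [G(theta, 1_N) = 0] into [A theta = tau * b theta], where [A = G(-, 1_N)],
    [b = g_n] and [tau = t / N], so that a leave-one-out problem is a solution
    path [u] of this equation run over the short interval [[0, 1 / N]].
    Differentiating the equation in [tau] expresses every derivative of [u]
    through partial derivatives of [A] and [b] and through the inverse of the
    Jacobian [dA - tau * db].  Once the derivatives of [g_n] are bounded by a
    constant that does not depend on [N], all these ingredients are, hence the
    derivatives of [u] up to order [kIJ + 1] are too ([ip_derivatives]).  The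
    infinitesimal jackknife is the Taylor polynomial of [u] of degree [kIJ] at
    [0], evaluated at [1 / N]; its error is therefore at most a constant times
    [N ^ -(kIJ + 1)] ([taylor_bound], [jackknife_error]).

    The control of the Jacobian comes from coercivity.  For a symmetric positive
    definite Hessian, a bound on the operator norm of the inverse is a lower
    bound on the quadratic form ([posdef_coercive]); unlike the former, the
    latter survives the nonsymmetric perturbation [tau * db] and passes to
    segments: a coercive map is expanding along every segment of [Omega]
    ([coercive_expanding]).  This makes the given solutions Lipschitz in the
    weights, so that they themselves form a continuous branch near [1_N], and
    every other branch agrees with them there ([local_solution_near]).

    Finally, the derivatives of [g_n] have to be bounded, with probability close
    to one and uniformly in [N], for the few indices [n] that were drawn.  As
    the indices are independent of the functions, which are identically
    distributed, the probability that some drawn index has a derivative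
    exceeding [Gamma] is at most [Nloo] times the sum over the orders of the
    probabilities of this event for the first observation, and these tend to [0]
    as [Gamma] grows ([derivatives_bounded_whp]).  Independence is a statement
    about the values of the functions; it reaches their derivatives because
    these are limits of difference quotients ([measurable_pderiv]) and because
    their suprema are determined by the points with rational coordinates
    ([not_exceeds_bound]). *)

(** * Functions of one real variable *)

Lemma is_derive_cvgP (R : realType) (f : R -> R) (t l : R) :
  is_derive t 1 f l <-> (h^-1 * (f (h + t) - f t)) @[h --> 0^'] --> l.
Proof.
have E : (fun h : R => h^-1 *: ((f \o shift t) (h *: (1 : R)) - f t)) =
    (fun h => h^-1 * (f (h + t) - f t)).
  by apply/funext => h /=; rewrite [_%:A]mulr1.
split=> [[df <-]|cl].
  by rewrite /derive E; move: df; rewrite /derivable E.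
apply: DeriveDef; first by rewrite /derivable E; apply/cvg_ex; exists l.
by rewrite /derive E; apply/cvg_lim.
Qed.

Lemma cvg_shift_dnbhs (R : realType) (t : R) : h + t @[h --> 0^'] --> t.
Proof.
apply: (@cvg_trans _ ((fun h => h + t) @ nbhs (0 : R))).
  exact/cvg_app/cvg_within.
have : h + t @[h --> (0 : R)] --> 0 + t.
  by apply: cvgD; [exact: cvg_id|exact: cvg_cst].
by rewrite add0r.
Qed.

Lemma is_derive_continuous (R : realType) (f : R -> R) (t l : R) :
  is_derive t 1 f l -> {for t, continuous f}.
Proof. by move=> [df _]; apply/differentiable_continuous/derivable1_diffP. Qed.

(** The two sides are limits of the same difference quotients, so the equality
    of the derivatives also holds, by the convention for [lim], where they do
    not exist; iterated derivatives along the line can thus be compared order by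
    order. *)
Lemma derive_line (R : realType) (V W : normedModType R) (f : V -> W)
    (p v : V) (s : R) :
  (derivable f (p + s *: v) v <-> derivable (fun r : R => f (p + r *: v)) s 1) /\
  'D_1 (fun r : R => f (p + r *: v)) s = 'D_v f (p + s *: v).
Proof.
have E : (fun h : R => h^-1 *: ((f \o shift (p + s *: v)) (h *: v) -
             f (p + s *: v))) =
   (fun h : R => h^-1 *: (((fun r : R => f (p + r *: v)) \o shift s) (h *: (1:R)) -
             f (p + s *: v))).
  apply/funext => h /=; congr (_ *: (f _ - _)).
  by rewrite [_%:A]mulr1 scalerDl addrCA.
by rewrite /derivable /derive E.
Qed.

Lemma is_derive_line (R : realType) (V W : normedModType R) (f : V -> W)
    (p v : V) (s : R) : derivable f (p + s *: v) v ->
  is_derive s 1 (fun r : R => f (p + r *: v)) ('D_v f (p + s *: v)).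
Proof.
have [d e] := derive_line f p v s.
by move=> /d ?; apply: DeriveDef => //; rewrite e.
Qed.

(** The product rule at a zero of the first factor, where continuity of the
    second factor is enough.  It differentiates expressions whose factors [r] are
    slopes, about which nothing more than continuity is known. *)
Lemma is_derive_slope (R : realType) (v r : R -> R) (t dv : R) :
  is_derive t 1 v dv -> {for t, continuous r} ->
  is_derive t 1 (fun s => (v s - v t) * r s) (dv * r t).
Proof.
move=> /is_derive_cvgP dv' rc; apply/is_derive_cvgP.
under eq_fun do rewrite subrr mul0r subr0 mulrA.
apply: cvgM => //.
exact: (cvg_comp (fun h => h + t) r (@cvg_shift_dnbhs _ t) rc).
Qed.

Lemma is_derive_affine (R : realType) (a b s : R) :
  is_derive s 1 (fun r : R => a + r * b) b.
Proof.
apply/is_derive_cvgP; apply: cvg_near_cst; near=> h.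
have h0 : h != 0 by near: h; exact: nbhs_dnbhs_neq.
by field.
Unshelve. all: by end_near. Qed.

Lemma near_norm_le (R : realType) (V : normedModType R) (x : V) (e : R) :
  0 < e -> \forall y \near x, `|y - x| <= e.
Proof.
move=> e0; have xx : id y @[y --> x] --> x by exact: cvg_id.
have := (@cvgrPdist_le _ _ _ _ (nbhs_filter x) _ _).1 xx _ e0.
by apply: filterS => y; rewrite distrC.
Qed.

Lemma near_lipschitz_continuous (R : realType) (V W : normedModType R)
    (f : V -> W) (x : V) (L : R) :
  (\forall y \near x, `|f y - f x| <= L * `|y - x|) -> {for x, continuous f}.
Proof.
move=> fL; suff : f y @[y --> x] --> f x by [].
apply/(@cvgrPdist_le _ _ _ _ (nbhs_filter x)) => e e0.
have L0 : 0 < `|L| + 1 by rewrite ltr_wpDl.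
have nx := near_norm_le x (divr_gt0 e0 L0).
near=> y.
have yx : `|y - x| <= e / (`|L| + 1) by near: y.
rewrite distrC; apply: (@le_trans _ _ (L * `|y - x|)); first by near: y.
move: yx; rewrite ler_pdivlMr// mulrC; apply: le_trans.
by rewrite ler_wpM2r// (le_trans (ler_norm _))// lerDl.
Unshelve. all: by end_near. Qed.

Lemma MVT01 (R : realType) (h dh : R -> R) :
  (forall s : R, 0 <= s <= 1 -> is_derive s 1 h (dh s)) ->
  exists2 s : R, 0 <= s <= 1 & h 1 - h 0 = dh s.
Proof.
move=> hd; have [|||c c01 e] := @MVT_segment R h dh 0 1.
- exact: ler01.
- by move=> x; rewrite in_itv/= => /andP[x0 x1]; apply: hd; rewrite !ltW.
- apply: derivable_within_continuous => x; rewrite in_itv/= => x01.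
  by have [] := hd x x01.
- by exists c; [move: c01; rewrite in_itv|rewrite e subr0 mulr1].
Qed.

(** By induction on [K]: the remainder of order [K + 1] of [F 0] has as
    derivative the remainder of order [K] of [F 1], and the mean value theorem
    turns a bound [C * t ^ K] of the latter into a bound [C * t ^ (K + 1)] of the
    former, vanishing at [0].  Using the mean value theorem instead of an integral
    loses the factor [1 / K!]. *)
Lemma taylor_bound (R : realType) (K : nat) (F : nat -> R -> R) (h C : R) :
  0 <= h ->
  (forall j, (j < K)%N -> forall t, 0 <= t <= h ->
     is_derive t 1 (F j) (F j.+1 t)) ->
  (forall t, 0 <= t <= h -> `|F K t| <= C) ->
  `|F 0%N h - \sum_(j < K) F j 0 * h ^+ j / j`!%:R| <= C * h ^+ K.
Proof.
elim: K F h => [|K IH] F h h0 dF FC.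
  by rewrite big_ord0 subr0 expr0 mulr1 FC// h0 lexx.
pose r (t : R) := F 0%N t - \sum_(j < K.+1) F j 0 * t ^+ j / j`!%:R.
pose r' (t : R) := F 1%N t - \sum_(j < K) F j.+1 0 * t ^+ j / j`!%:R.
have dr (t : R) : 0 <= t <= h -> is_derive t 1 r (r' t).
  move=> t0h; rewrite /r.
  have -> : (fun t => F 0%N t - \sum_(j < K.+1) F j 0 * t ^+ j / j`!%:R) =
     F 0%N - (cst (F 0%N 0) +
       \sum_(j < K) (fun t => (F j.+1 0 / j.+1`!%:R) *: t ^+ j.+1)).
    apply/funext => s; rewrite !fctE fct_sumE/= big_ord_recl/= expr0 fact0.
    rewrite divr1 mulr1; congr (_ - (_ + _)); apply: eq_bigr => j _.
    by rewrite /bump/= add1n /GRing.scale/=; ring.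
  have d0 := dF 0%N isT t t0h.
  have de (j : 'I_K) : is_derive t 1 (fun t => (F j.+1 0 / j.+1`!%:R) *: t ^+ j.+1)
       (F j.+1 0 * t ^+ j / j`!%:R).
    have dX : is_derive t 1 (fun t : R => t ^+ j.+1) (j.+1%:R * t ^+ j).
      apply: DeriveDef; first exact: exprn_derivable.
      by rewrite exp_derive /GRing.scale/= mulr1.
    apply: is_derive_eq (is_deriveZ _ dX) _.
    rewrite /GRing.scale/= factS natrM.
    have j1 : (j.+1%:R : R) != 0 by rewrite pnatr_eq0.
    have j2 : (j`!%:R : R) != 0 by rewrite pnatr_eq0 -lt0n fact_gt0.
    by field; rewrite j2 nat1r j1.
  have := is_deriveB d0 (is_deriveD (is_derive_cst (F 0%N 0) t 1) (is_derive_sum de)).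
  by rewrite add0r.
have r'C (t : R) : 0 <= t <= h -> `|r' t| <= C * t ^+ K.
  move=> /andP[t0 th]; apply: (IH (fun j => F j.+1)) => //.
    move=> j jK s /andP[s0 st]; apply: dF => //.
    by rewrite s0 (le_trans st).
  by move=> s /andP[s0 st]; apply: FC; rewrite s0 (le_trans st).
have C0 : 0 <= C by apply: le_trans (FC 0 _); rewrite ?normr_ge0 ?lexx.
have [c c0h e] : exists2 c, c \in `[0, h]%R & r h - r 0 = r' c * (h - 0).
  apply: MVT_segment => // [x /[!in_itv]/= /andP[x0 xh]|].
    by apply: dr; rewrite !ltW.
  apply: derivable_within_continuous => x; rewrite in_itv/= => x0h.
  by have [] := dr x x0h.
have r0 : r 0 = 0.
  rewrite /r big_ord_recl/= expr0 fact0 divr1 mulr1 big1 ?addr0 ?subrr// => j _.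
  by rewrite /bump/= add1n expr0n/= mulr0 mul0r.
rewrite -/(r h) -[r h]subr0 -r0 e subr0 normrM (ger0_norm h0) exprSr mulrA.
move: c0h; rewrite in_itv/= => /andP[c0 ch].
rewrite ler_wpM2r// (le_trans (r'C c _)) ?c0//.
by rewrite ler_wpM2l// lerXn2r ?nnegrE.
Qed.

(** * Maps with continuous partial derivatives *)

Lemma rV_norm_leP (R : realType) (m : nat) (x : 'rV[R]_m) (e : R) : 0 <= e ->
  `|x| <= e <-> forall i, `|x 0 i| <= e.
Proof.
move=> e0; rewrite [`|x|]/Num.Def.normr/= mx_normrE; split.
  move=> h i; apply: le_trans h.
  exact: (le_bigmax _ (fun ij => `|x ij.1 ij.2|) (0, i)).
by move=> h; apply: bigmax_le => // -[i j] _; rewrite ord1.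
Qed.

Lemma rV_continuous (R : realType) (m : nat) (u : R -> 'rV[R]_m) (t : R) :
  (forall j, {for t, continuous (fun s => u s 0 j)}) -> {for t, continuous u}.
Proof.
move=> uc.
suff : u s @[s --> t] --> u t by [].
apply/(@cvgrPdist_le _ _ _ _ (nbhs_filter t)) => e e0.
have /filter_forall H : forall j, \forall s \near t, `|u t 0 j - u s 0 j| <= e.
  by move=> j; have /(@cvgrPdist_le _ _ _ _ (nbhs_filter t))/(_ e e0) := uc j.
apply: filterS H => s us; apply/rV_norm_leP => [|j]; first exact: ltW.
by have := us j; rewrite !mxE.
Qed.

(** The partial derivatives [dF] are a parameter, so that for a map built from
    others they can be given by the expected formula. *)
Definition C1_on (R : realType) (m : nat) (Omega : set 'rV[R]_m)
    (F : 'rV[R]_m -> R) (dF : 'I_m -> 'rV[R]_m -> R) : Prop :=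
  forall y, Omega y -> forall j,
    is_derive y (delta_mx 0 j) F (dF j y) /\ {for y, continuous (dF j)}.

(** Changing the coordinates of [x] into those of [y] one at a time splits the
    increment of [F] into [m] steps, each of which is a slope times the change of
    one coordinate.  By the mean value theorem this slope is a value of a partial
    derivative at a point not farther from [x] than [y], hence its continuity at
    [x].  This form of differentiability composes with paths through
    [is_derive_slope]. *)
Lemma hadamard (R : realType) (m : nat) (Omega : set 'rV[R]_m)
    (F : 'rV[R]_m -> R) (dF : 'I_m -> 'rV[R]_m -> R) (x : 'rV[R]_m) :
  open Omega -> C1_on Omega F dF -> Omega x ->
  exists q : 'I_m -> 'rV[R]_m -> R,
    [/\ forall j, {for x, continuous (q j)}, forall j, q j x = dF j x
      & forall y, F y - F x = \sum_j (y 0 j - x 0 j) * q j y].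
Proof.
move=> oO cF Ox.
pose z (y : 'rV[R]_m) (k : nat) : 'rV[R]_m := \row_j (if (j < k)%N then y 0 j else x 0 j).
have zS y (j : 'I_m) : z y j.+1 = z y j + (y 0 j - x 0 j) *: delta_mx 0 j.
  apply/rowP => i; rewrite !mxE eqxx/= eq_sym -val_eqE/= ltnS leq_eqVlt eq_sym.
  case: ltngtP => [||/val_inj ->]; rewrite ?mulr0 ?mulr1 ?addr0//=.
  by rewrite addrC subrK.
(* Where [y] and [x] agree in coordinate [j], the slope is set to its limit. *)
pose q (j : 'I_m) (y : 'rV[R]_m) := if y 0 j == x 0 j then dF j x
  else (F (z y j.+1) - F (z y j)) / (y 0 j - x 0 j).
exists q; split.
- move=> j.
  suff : q j y @[y --> x] --> q j x by [].
  have -> : q j x = dF j x by rewrite /q eqxx.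
  apply/(@cvgrPdist_le _ _ _ _ (nbhs_filter x)) => e e0.
  have [r /= r0 rO] : exists2 r : R, 0 < r &
      forall y : 'rV[R]_m, `|x - y| <= r -> Omega y /\ `|dF j x - dF j y| <= e.
    have H : nbhs x (Omega `&` [set y | `|dF j x - dF j y| <= e]).
      apply: filterI; first exact: open_nbhs_nbhs.
      by have [_ /(@cvgrPdist_le _ _ _ _ (nbhs_filter x))/(_ e e0)] := cF _ Ox j.
    have [r /= r0 rO] := (nbhs_ballP _ _).1 H.
    exists (r / 2); first by rewrite divr_gt0.
    move=> y xy; have [|//] := rO y.
    by rewrite -ball_normE/=; rewrite (le_lt_trans xy)// ltr_pdivrMr// ltr_pMr// ltr1n.
  apply/nbhs_ballP; exists r => //= y; rewrite -ball_normE/= => /ltW xy.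
  rewrite /q; case: eqP => [_|/eqP yx]; first by rewrite subrr normr0 ltW.
  pose p (s : R) := z y j + (s * (y 0 j - x 0 j)) *: delta_mx 0 j.
  have pin s : 0 <= s <= 1 -> `|x - p s| <= r.
    move=> s01; apply/rV_norm_leP => [|i]; first exact: ltW.
    have xyi := (rV_norm_leP (x - y) (ltW r0)).1 xy.
    rewrite /p !mxE eqxx/=; case: (i =P j) => [->|_]; last first.
      rewrite mulr0 addr0; case: ifP => _; first by have := xyi i; rewrite !mxE.
      by rewrite subrr normr0 ltW.
    rewrite ltnn mulr1 opprD addrA subrr sub0r -mulrN opprB.
    have := xyi j; rewrite !mxE; apply: le_trans.
    case/andP: s01 => s0 s1.
    by rewrite normrM (ger0_norm s0) ler_piMl.
  have [|s s01] := @MVT01 R (fun s : R => F (p s))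
      (fun s : R => dF j (p s) * (y 0 j - x 0 j)).
    move=> s s01; have [Op _] := rO _ (pin s s01).
    have [dd <-] := (cF _ Op j).1.
    have := @is_derive_line R _ _ F (z y j) (delta_mx 0 j) (s * (y 0 j - x 0 j)) dd.
    rewrite -/(p s) => D1.
    have D2 : is_derive s 1 (fun s : R => s * (y 0 j - x 0 j)) (y 0 j - x 0 j).
      apply: is_derive_eq; rewrite /GRing.scale/=; ring.
    by have := @is_derive1_comp R _ _ s _ _ D1 D2.
  have -> : F (p 1) - F (p 0) = F (z y j.+1) - F (z y j).
    by rewrite /p mul1r mul0r scale0r addr0 zS.
  move=> ->; rewrite mulfK ?subr_eq0//.
  by have [_] := rO _ (pin s s01).
- by move=> j; rewrite /q eqxx.
- move=> y.
  have -> : F y - F x = \sum_(0 <= k < m) (F (z y k.+1) - F (z y k)).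
    rewrite telescope_sumr//; congr (F _ - F _); apply/rowP => i; rewrite !mxE//.
    by rewrite ltn_ord.
  rewrite big_mkord; apply: eq_bigr => j _; rewrite /q; case: eqP => [yx|/eqP yx].
    by rewrite zS yx subrr scale0r addr0 mul0r subrr.
  by rewrite mulrCA divff ?mulr1 ?subr_eq0.
Qed.

Lemma is_derive_path (R : realType) (m : nat) (Omega : set 'rV[R]_m)
    (F : 'rV[R]_m -> R) (dF : 'I_m -> 'rV[R]_m -> R) (u : R -> 'rV[R]_m)
    (du : 'I_m -> R) (t : R) :
  open Omega -> C1_on Omega F dF -> Omega (u t) ->
  (forall j, is_derive t 1 (fun s => u s 0 j) (du j)) ->
  is_derive t 1 (fun s => F (u s)) (\sum_j du j * dF j (u t)).
Proof.
move=> oO cF Ou ud.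
have [q [qc qE Fq]] := hadamard oO cF Ou.
have uc : {for t, continuous u}.
  by apply: rV_continuous => j; apply: is_derive_continuous (ud j).
have -> : (fun s => F (u s)) =
    cst (F (u t)) + \sum_j (fun s => (u s 0 j - u t 0 j) * q j (u s)).
  apply/funext => s; rewrite fctE fct_sumE/= -Fq; ring.
have D j : is_derive t 1 (fun s => (u s 0 j - u t 0 j) * q j (u s))
    (du j * dF j (u t)).
  rewrite -qE; apply: is_derive_slope (ud j) _.
  by apply: (continuous_comp uc); apply: qc.
by apply: is_derive_eq; rewrite add0r.
Qed.

Lemma C1_pderiv (R : realType) (m K n : nat) (Omega : set 'rV[R]_m)
    (f : 'rV[R]_m -> 'rV[R]_n) (s : seq 'I_m) (i : 'I_n) :
  Cn_on K Omega f -> (size s < K)%N ->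
  C1_on Omega (fun y => pderiv s f y 0 i) (fun j y => pderiv (j :: s) f y 0 i).
Proof.
move=> [df cf] sK y Oy j.
have dfy := df s j sK y Oy; split.
  apply: DeriveDef; first by move: (dfy) => /derivable_mxP; apply.
  by rewrite /= (derive_mx dfy) mxE.
have := cf (j :: s) sK y Oy => cc.
exact: (@continuous_comp _ _ _ (pderiv (j :: s) f) (fun M : 'rV[R]_n => M 0 i) y
  cc (@coord_continuous _ _ _ _ _ _)).
Qed.

Lemma C1_onB (R : realType) (m : nat) (Omega : set 'rV[R]_m)
    (F G : 'rV[R]_m -> R) (dF dG : 'I_m -> 'rV[R]_m -> R) (k : R) :
  C1_on Omega F dF -> C1_on Omega G dG ->
  C1_on Omega (fun y => F y - k * G y) (fun j y => dF j y - k * dG j y).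
Proof.
move=> cF cG y Oy j; have [dFj cFj] := cF y Oy j; have [dGj cGj] := cG y Oy j.
split; first by have := is_deriveB dFj (is_deriveZ k dGj).
by apply: continuousB => //; apply: continuousM => //; exact: cst_continuous.
Qed.

(** * Coercive maps *)

(** [dF i j] is meant to be the [j]-th partial derivative of the [i]-th
    component of a map.  The Jacobian is not assumed to be symmetric, so that the
    property can be transferred to [A - tau * b]. *)
Definition coercive_on (R : realType) (m : nat) (Omega : set 'rV[R]_m) (c : R)
    (dF : 'I_m -> 'I_m -> 'rV[R]_m -> R) : Prop :=
  forall y, Omega y -> forall x : 'rV[R]_m,
    c * (\sum_i x 0 i ^+ 2) <= \sum_i \sum_j x 0 i * x 0 j * dF i j y.

Lemma coercive_weaken (R : realType) (m : nat) (Omega : set 'rV[R]_m) (c c' : R)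
    (dF : 'I_m -> 'I_m -> 'rV[R]_m -> R) :
  c' <= c -> coercive_on Omega c dF -> coercive_on Omega c' dF.
Proof.
move=> cc cF y Oy x; apply: le_trans (cF y Oy x).
by rewrite ler_wpM2r// sumr_ge0// => i _; exact: sqr_ge0.
Qed.

(** Since [2 * |x_i| * |x_j| <= x_i ^ 2 + x_j ^ 2], entries bounded by [e]
    contribute at most [e * m] times the squared Euclidean norm. *)
Lemma coercive_perturb (R : realType) (m : nat) (Omega : set 'rV[R]_m)
    (c e : R) (dF dG : 'I_m -> 'I_m -> 'rV[R]_m -> R) :
  coercive_on Omega c dF ->
  (forall y, Omega y -> forall i j, `|dG i j y - dF i j y| <= e) ->
  coercive_on Omega (c - e * m%:R) dG.
Proof.
move=> cF dFG y Oy x.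
rewrite mulrBl lerBlDr.
apply: le_trans (cF y Oy x) _.
rewrite -lerBlDl -sumrB.
apply: (@le_trans _ _ (\sum_i \sum_(j < m) e * ((x 0 i ^+ 2 + x 0 j ^+ 2) / 2))).
  apply: ler_sum => i _; rewrite -sumrB; apply: ler_sum => j _.
  rewrite -mulrBr; apply: le_trans (ler_norm _) _.
  rewrite normrM mulrC distrC.
  apply: ler_pM => //; first exact: dFG.
  rewrite normrM ler_pdivlMr// -subr_ge0 -[x 0 i ^+ 2]real_normK ?num_real//.
  rewrite -[x 0 j ^+ 2]real_normK ?num_real//.
  apply: le_trans (sqr_ge0 (`|x 0 i| - `|x 0 j|)) _.
  by rewrite le_eqVlt; apply/orP; left; apply/eqP; ring.
rewrite le_eqVlt; apply/orP; left; apply/eqP.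
have E1 : \sum_(i < m) \sum_(j < m) x 0 i ^+ 2 = m%:R * \sum_i x 0 i ^+ 2.
  by rewrite mulr_sumr; apply: eq_bigr => i _; rewrite sumr_const card_ord mulr_natl.
have E2 : \sum_(i < m) \sum_(j < m) x 0 j ^+ 2 = m%:R * \sum_i x 0 i ^+ 2.
  by rewrite exchange_big.
transitivity (e / 2 * (\sum_(i < m) \sum_(j < m) x 0 i ^+ 2 +
    \sum_(i < m) \sum_(j < m) x 0 j ^+ 2)).
  rewrite -big_split/= mulr_sumr; apply: eq_bigr => i _.
  by rewrite -big_split/= mulr_sumr; apply: eq_bigr => j _; field.
by rewrite E1 E2; field.
Qed.

(** The function [s |-> <D, F (x + s * D)>], with [D = y - x], has derivative
    at least [c * |D| ^ 2] by coercivity, while its total increment is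
    [<D, F y - F x>].  The factor [m] pays for the use of the max norm. *)
Lemma coercive_expanding (R : realType) (m : nat) (Omega : set 'rV[R]_m) (c : R)
    (F : 'I_m -> 'rV[R]_m -> R) (dF : 'I_m -> 'I_m -> 'rV[R]_m -> R)
    (x y : 'rV[R]_m) (e : R) :
  open Omega -> (forall i, C1_on Omega (F i) (dF i)) -> 0 < c ->
  coercive_on Omega c dF ->
  (forall s : R, 0 <= s <= 1 -> Omega (x + s *: (y - x))) ->
  (forall i, `|F i y - F i x| <= e) -> c * `|y - x| <= m%:R * e.
Proof.
move=> oO cF c0 cc seg Fe.
set D := y - x; have [D0|D0] := eqVneq `|D| 0.
  rewrite D0 mulr0; have [m0|m0] := posnP m; first by rewrite m0 mul0r.
  by rewrite mulr_ge0//; apply: le_trans (Fe (Ordinal m0)).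
have [i0 Di0] : exists i, `|D| = `|D 0 i|.
  have [[i j] ij] := mx_norm_neq0 D0.
  by exists j; rewrite [LHS]ij/= ord1.
have [|s s01] := @MVT01 R (fun s => \sum_i D 0 i * F i (x + s *: D))
   (fun s => \sum_i \sum_j D 0 i * D 0 j * dF i j (x + s *: D)).
  move=> s s01.
  have dl j : is_derive s 1 (fun s : R => (x + s *: D) 0 j) (D 0 j).
    have -> : (fun s : R => (x + s *: D) 0 j) = fun r => x 0 j + r * D 0 j.
      by apply/funext => r; rewrite [LHS]mxE [X in _ + X]mxE.
    exact: is_derive_affine.
  have dd i : is_derive s 1 (fun s : R => F i (x + s *: D))
      (\sum_j D 0 j * dF i j (x + s *: D)).
    exact: (@is_derive_path _ _ Omega (F i) (dF i) (fun s : R => x + s *: D)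
      (fun j => D 0 j) s oO (cF i) (seg _ s01) dl).
  have -> : (fun s => \sum_i D 0 i * F i (x + s *: D)) =
     \sum_i (fun s => D 0 i * F i (x + s *: D)).
    by apply/funext => r; rewrite fct_sumE.
  apply: is_derive_eq; apply: eq_bigr => i _.
  rewrite /GRing.scale/= mulr_sumr.
  by apply: eq_bigr => j _; rewrite mulrA.
have xD : x + D = y by rewrite /D addrC subrK.
rewrite scale1r scale0r addr0 xD => E.
have := cc _ (seg _ s01) D; rewrite -/D -E -sumrB => H.
have D_ge0 : 0 < `|D| by rewrite lt_neqAle eq_sym D0 normr_ge0.
rewrite -(ler_pM2r D_ge0).
have H1 : `|D| ^+ 2 <= \sum_i D 0 i ^+ 2.
  rewrite Di0 real_normK ?num_real// (bigD1 i0)//= lerDl.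
  by apply: sumr_ge0 => i _; exact: sqr_ge0.
apply: le_trans (_ : c * \sum_i D 0 i ^+ 2 <= _).
  by rewrite -mulrA -expr2 ler_pM2l.
apply: (le_trans H).
rewrite (_ : m%:R * e * `|D| = \sum_(i < m) e * `|D|); last first.
  by rewrite sumr_const card_ord -[RHS]mulr_natl mulrA.
apply: ler_sum => i _; rewrite -mulrBr mulrC.
apply: le_trans (ler_norm _) _; rewrite normrM; apply: ler_pM => //.
by have := (rV_norm_leP D (normr_ge0 D)).1 (lexx _) i.
Qed.

(** * Inverses of matrices depending on a parameter *)

Lemma cvg_bounded0 (R : realType) (F : set_system R) {FF : Filter F}
    (a b : R -> R) (C : R) :
  (\forall h \near F, `|a h| <= C) -> b h @[h --> F] --> (0 : R) ->
  a h * b h @[h --> F] --> (0 : R).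
Proof.
move=> aC b0; apply/cvgr0Pnorm_le => e e0.
have C1 : 0 < `|C| + 1 by rewrite ltr_wpDl.
have /cvgr0Pnorm_le/(_ (e / (`|C| + 1)) (divr_gt0 e0 C1)) bs := b0.
near=> h; rewrite normrM.
have ah : `|a h| <= `|C| + 1.
  apply: le_trans (_ : C <= _); first by near: h.
  by rewrite (le_trans (ler_norm _))// lerDl.
apply: le_trans (ler_pM _ _ ah (_ : `|b h| <= e / (`|C| + 1))) _ => //.
  by near: h.
by rewrite mulrC divfK// gt_eqF.
Unshelve. all: by end_near. Qed.

Lemma cvg_sum_ord (R : realType) (F : set_system R) {FF : Filter F} (n : nat)
    (f : 'I_n -> R -> R) (a : 'I_n -> R) :
  (forall i, f i h @[h --> F] --> a i) ->
  \sum_i f i h @[h --> F] --> \sum_i a i.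
Proof. by move=> fa; apply: cvg_big => //; exact: add_continuous. Qed.

(** If [A v] is the [j]-th basis vector, coercivity at [v] reads
    [c * |v| ^ 2 <= v_j], which bounds [v_j] and then all coordinates of [v]. *)
Lemma coercive_invmx (R : realType) (m : nat) (A : 'M[R]_m) (c : R) : 0 < c ->
  (forall x : 'rV[R]_m,
     c * (\sum_i x 0 i ^+ 2) <= \sum_i \sum_j x 0 i * x 0 j * A i j) ->
  A \in unitmx /\ forall i j, `|invmx A i j| <= c^-1.
Proof.
move=> c0 cA.
have uA : A \in unitmx.
  rewrite -row_free_unit; apply/inj_row_free => v vA.
  have : c * (\sum_i v 0 i ^+ 2) <= 0.
    apply: le_trans (cA v) _; rewrite exchange_big/= big1// => j _.
    transitivity (v 0 j * (v *m A) 0 j); last by rewrite vA mxE mulr0.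
    rewrite mxE mulr_sumr; apply: eq_bigr => i _; ring.
  rewrite pmulr_rle0// => s0.
  have /eqP : \sum_i v 0 i ^+ 2 = 0.
    by apply/eqP; rewrite eq_le s0 sumr_ge0// => i _; exact: sqr_ge0.
  rewrite psumr_eq0 => [/allP v0|i _]; last exact: sqr_ge0.
  apply/rowP => i; rewrite mxE.
  by have := v0 i (mem_index_enum i); rewrite sqrf_eq0 => /eqP.
split=> // i j.
pose v : 'rV[R]_m := \row_k invmx A k j.
have E : \sum_k \sum_l v 0 k * v 0 l * A k l = v 0 j.
  transitivity (\sum_k v 0 k * (A *m invmx A) k j).
    apply: eq_bigr => k _; rewrite [X in _ = _ * X]mxE mulr_sumr.
    by apply: eq_bigr => l _; rewrite /v !mxE; ring.
  rewrite mulmxV// (bigD1 j)//= [X in _ * X + _]mxE eqxx mulr1 big1 ?addr0// => k kj.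
  by rewrite [X in _ * X]mxE (negbTE kj) mulr0.
have B k : c * `|v 0 k| ^+ 2 <= `|v 0 j|.
  apply: le_trans (ler_norm _); rewrite -E; apply: le_trans (cA v).
  rewrite ler_pM2l// real_normK ?num_real// (bigD1 k)//= lerDl.
  by apply: sumr_ge0 => l _; exact: sqr_ge0.
have vj : `|v 0 j| <= c^-1.
  have [->|vj0] := eqVneq `|v 0 j| 0; first by rewrite invr_ge0 ltW.
  have vjp : 0 < `|v 0 j| by rewrite lt_neqAle eq_sym vj0 normr_ge0.
  by rewrite -[leRHS]mul1r ler_pdivlMr// -(ler_pM2r vjp) mul1r mulrAC -expr2 mulrC.
have -> : invmx A i j = v 0 i by rewrite mxE.
rewrite -(@ler_pXn2r _ 2) ?nnegrE ?invr_ge0 ?(ltW c0)//.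
rewrite -(ler_pM2l c0) (le_trans (B i))// (le_trans vj)//.
by rewrite expr2 mulrA divff ?mul1r// gt_eqF.
Qed.

(** The resolvent identity [B^-1 - A^-1 = - B^-1 (B - A) A^-1], arranged as a
    sum of slopes for [is_derive_slope]. *)
Lemma invmx_sub (R : realType) (m : nat) (A B : 'M[R]_m) i j :
  A \in unitmx -> B \in unitmx ->
  invmx B i j - invmx A i j =
  \sum_p \sum_q (B p q - A p q) * (- (invmx B i p * invmx A q j)).
Proof.
move=> uA uB.
transitivity ((invmx B *m (A - B) *m invmx A) i j).
  by rewrite mulmxBr mulVmx// mulmxBl mul1mx -mulmxA mulmxV// mulmx1 !mxE.
rewrite mxE exchange_big/=; apply: eq_bigr => q _.
rewrite mxE mulr_suml; apply: eq_bigr => p _; rewrite !mxE; ring.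
Qed.

(** The resolvent identity is used twice.  With the bound on the inverses it is
    an estimate, which makes the inverse continuous at [t]; and it then displays
    the increment of the inverse as a sum of increments of [A] times continuous
    factors, which can be differentiated. *)
Lemma is_derive_invmx (R : realType) (m : nat) (A : R -> 'M[R]_m)
    (dA : 'M[R]_m) (t C : R) :
  (forall i j, is_derive t 1 (fun s => A s i j) (dA i j)) ->
  (\forall s \near t,
     A s \in unitmx /\ forall i j, `|invmx (A s) i j| <= C) ->
  forall i j, is_derive t 1 (fun s => invmx (A s) i j)
    (- \sum_p \sum_q invmx (A t) i p * dA p q * invmx (A t) q j).
Proof.
move=> dAt nA.
have [uAt bAt] := nbhs_singleton nA.
have Ac p q : A s p q @[s --> t] --> A t p q := is_derive_continuous (dAt p q).
have Ic i j : {for t, continuous (fun s => invmx (A s) i j)}.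
  suff H : invmx (A s) i j - invmx (A t) i j @[s --> t] --> (0 : R).
    have := cvgD H (cvg_cst (invmx (A t) i j)).
    rewrite add0r => Hc.
    suff : (fun s => invmx (A s) i j) @ t --> invmx (A t) i j by [].
    have -> : (fun s => invmx (A s) i j) =
        (fun s => invmx (A s) i j - invmx (A t) i j) + cst (invmx (A t) i j).
      by apply/funext => s /=; rewrite !fctE subrK.
    exact: Hc.
  have Hpq p q : - (invmx (A s) i p * invmx (A t) q j) * (A s p q - A t p q)
      @[s --> t] --> (0 : R).
    apply: (@cvg_bounded0 _ _ _ _ _ (C * C)).
      apply: filterS nA => s [_ bs]; rewrite normrN normrM.
      by apply: ler_pM.
    rewrite -[X in _ --> X](subrr (A t p q)); exact: (cvgB (Ac p q) (cvg_cst (A t p q))).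
  have := cvg_sum_ord (fun p => cvg_sum_ord (Hpq p)).
  rewrite big1 => [H0|p _]; last by rewrite big1.

  have E : {near t, (fun s => \sum_p \sum_q
      - (invmx (A s) i p * invmx (A t) q j) * (A s p q - A t p q)) =1
      (fun s => invmx (A s) i j - invmx (A t) i j)}.
    apply: filterS nA => s [us _]; rewrite (invmx_sub _ _ uAt us).
    by apply: eq_bigr => p _; apply: eq_bigr => q _; rewrite mulrC.
  exact: cvg_trans (near_eq_cvg E) (H0 _ _).
move=> i j.
pose g := fun s => invmx (A t) i j + \sum_p \sum_q
   (A s p q - A t p q) * (- (invmx (A s) i p * invmx (A t) q j)).
apply: (@near_eq_is_derive _ _ _ g).
  apply: filterS nA => s [us _].
  by rewrite /g -(invmx_sub _ _ uAt us) addrC subrK.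
have -> : g = cst (invmx (A t) i j) + \sum_p \sum_q (fun s =>
   (A s p q - A t p q) * (- (invmx (A s) i p * invmx (A t) q j))).
  apply/funext => s; rewrite /g !fctE fct_sumE; congr (_ + _).
  by apply: eq_bigr => p _; rewrite fct_sumE.
have D p q : is_derive t 1 (fun s => (A s p q - A t p q) *
     (- (invmx (A s) i p * invmx (A t) q j)))
     (dA p q * (- (invmx (A t) i p * invmx (A t) q j))).
  apply: (@is_derive_slope _ _ (fun s => - (invmx (A s) i p * invmx (A t) q j))) => //.
  by apply: continuousN; apply: continuousM => //; exact: cst_continuous.
have := is_deriveD (is_derive_cst (invmx (A t) i j) t 1)
  (is_derive_sum (fun p => is_derive_sum (D p))).
congr (is_derive _ _ _ _); rewrite add0r -sumrN; apply: eq_bigr => p _.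
by rewrite -sumrN; apply: eq_bigr => q _; ring.
Qed.

(** * Families with uniformly bounded derivatives *)

Section UniformlySmooth.
Context (R : realType) (L : Type) (dom : L -> set R).
Implicit Types f g : L -> R -> R.

(** The family [f] has derivatives up to order [r], bounded on the domains
    [dom l] by constants that serve all members at once.  Indexing the family by
    the type of all data of a problem is how a constant is shown to be independent
    of these data. *)
Fixpoint unif_smooth (r : nat) f : Prop :=
  (exists C, forall l t, dom l t -> `|f l t| <= C) /\
  match r with
  | 0%N => True
  | r'.+1 => exists f', unif_smooth r' f' /\
      forall l t, dom l t -> is_derive t 1 (f l) (f' l t)
  end.

Lemma unif_smooth_bounded r f : unif_smooth r f ->
  exists C, forall l t, dom l t -> `|f l t| <= C.
Proof. by case: r => [|r] []. Qed.

Lemma unif_smoothS r f : unif_smooth r.+1 f -> unif_smooth r f.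
Proof.
elim: r f => [|r IH] f [bf [f' [f'r df]]]; first by split.
by split=> //; exists f'; split => //; exact: IH.
Qed.

Lemma unif_smooth_cst r (c : R) : unif_smooth r (fun _ _ => c).
Proof.
elim: r c => [|r IH] c; first by split=> //; exists `|c|.
split; first by exists `|c|.
by exists (fun _ _ => 0); split => // l t _; apply: is_derive_cst.
Qed.

Lemma unif_smoothD r f g : unif_smooth r f -> unif_smooth r g ->
  unif_smooth r (fun l t => f l t + g l t).
Proof.
elim: r f g => [|r IH] f g [[C fC] fr] [[B gB] gr]; split;
  try by exists (C + B) => l t lt; rewrite (le_trans (ler_normD _ _))// lerD// ?fC ?gB.
  by [].
have [f' [f'r df]] := fr; have [g' [g'r dg]] := gr.
exists (fun l t => f' l t + g' l t); split; first exact: IH.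
by move=> l t lt; have := df l t lt; have := dg l t lt => *; apply: is_deriveD.
Qed.

Lemma unif_smoothM r f g : unif_smooth r f -> unif_smooth r g ->
  unif_smooth r (fun l t => f l t * g l t).
Proof.
elim: r f g => [|r IH] f g fr gr.
  have [[C fC] _] := fr; have [[B gB] _] := gr; split => //.
  by exists (C * B) => l t lt; rewrite normrM ler_pM// ?fC ?gB.
have [C fC] := unif_smooth_bounded fr; have [B gB] := unif_smooth_bounded gr.
split; first by exists (C * B) => l t lt; rewrite normrM ler_pM// ?fC ?gB.
have [_ [f' [f'r df]]] := fr; have [_ [g' [g'r dg]]] := gr.
exists (fun l t => f l t * g' l t + g l t * f' l t); split.
  by apply: unif_smoothD; apply: IH => //; exact: unif_smoothS.
by move=> l t lt; have := df l t lt; have := dg l t lt => *; apply: is_deriveM.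
Qed.

Lemma unif_smooth_sum r n (f : 'I_n -> L -> R -> R) :
  (forall i, unif_smooth r (f i)) -> unif_smooth r (fun l t => \sum_i f i l t).
Proof.
elim: n f => [|n IH] f fr.
  have -> : (fun l t => \sum_(i < 0) f i l t) = fun _ _ => 0.
    by apply/funext => l; apply/funext => t; rewrite big_ord0.
  exact: unif_smooth_cst.
have -> : (fun l t => \sum_(i < n.+1) f i l t) =
    fun l t => \sum_(i < n) f (widen_ord (leqnSn n) i) l t + f ord_max l t.
  by apply/funext => l; apply/funext => t; rewrite big_ord_recr.
by apply: unif_smoothD => //; apply: IH.
Qed.

Lemma unif_smooth_chain r f : unif_smooth r f ->
  exists F : nat -> L -> R -> R, exists C : R,
  [/\ F 0%N = f,
      forall j, (j < r)%N -> forall l t, dom l t ->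
        is_derive t 1 (F j l) (F j.+1 l t)
    & forall l t, dom l t -> `|F r l t| <= C].
Proof.
elim: r f => [|r IH] f [[C fC] fr]; first by exists (fun _ => f), C.
have [f' [/IH[F [B [F0 FS FB]]] df]] := fr.
exists (fun j => if j is j'.+1 then F j' else f), B; split => // -[|j] jr l t lt.
  by rewrite F0; exact: df.
exact: FS.
Qed.

End UniformlySmooth.

(** * Derivatives of a solution path *)

Section ImplicitPath.
Context (R : realType) (D K : nat) (Omega : set 'rV[R]_D).
Context (Omega_open : open Omega).
Context (c B : R).
Context (c_gt0 : 0 < c) (K_gt0 : (0 < K)%N).

(** All that is used about a solution path [u] of [A u = t * b u], packed so
    that [unif_smooth] families can be indexed by it.  The number of observations,
    the outcome and the observation left out only enter through such a record,
    whereas [Omega], [c] and [B] are the same for all paths. *)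
Record implicit_path := ImplicitPath {
  ip_A : 'rV[R]_D -> 'rV[R]_D;
  ip_b : 'rV[R]_D -> 'rV[R]_D;
  ip_u : R -> 'rV[R]_D;
  ip_dom : set R;
  ip_dom_open : open ip_dom;
  ip_dom_bounded : forall t, ip_dom t -> `|t| <= 2;
  ip_smoothA : Cn_on K Omega ip_A;
  ip_smoothb : Cn_on K Omega ip_b;
  ip_boundA : forall s : seq 'I_D, (0 < size s <= K)%N ->
    forall theta, Omega theta -> forall i, `|pderiv s ip_A theta 0 i| <= B;
  ip_boundb : forall s : seq 'I_D, (size s <= K)%N ->
    forall theta, Omega theta -> forall i, `|pderiv s ip_b theta 0 i| <= B;
  ip_coercive : forall t, ip_dom t -> coercive_on Omega c (fun i j theta =>
    pderiv [:: j] ip_A theta 0 i - t * pderiv [:: j] ip_b theta 0 i);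
  ip_equation : forall t, ip_dom t -> ip_A (ip_u t) = t *: ip_b (ip_u t);
  ip_segment : forall s t r, ip_dom s -> ip_dom t -> 0 <= r <= 1 ->
    Omega (ip_u s + r *: (ip_u t - ip_u s)) }.

Implicit Type l : implicit_path.

Lemma ip_in l t : ip_dom l t -> Omega (ip_u l t).
Proof.
move=> lt; have := @ip_segment l t t 0 lt lt.
by rewrite scale0r addr0 lexx ler01; apply.
Qed.

Let Phi l t i (theta : 'rV[R]_D) := ip_A l theta 0 i - t * ip_b l theta 0 i.
Let dPhi l t i j (theta : 'rV[R]_D) :=
  pderiv [:: j] (ip_A l) theta 0 i - t * pderiv [:: j] (ip_b l) theta 0 i.

Let C1_Phi l t i : C1_on Omega (Phi l t i) (dPhi l t i).
Proof.
have HA := @C1_pderiv _ _ _ _ _ _ [::] i (ip_smoothA l) K_gt0.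
have Hb := @C1_pderiv _ _ _ _ _ _ [::] i (ip_smoothb l) K_gt0.
exact: C1_onB HA Hb.
Qed.

Let Phi_path l t s i : ip_dom l t -> ip_dom l s ->
  Phi l t i (ip_u l s) - Phi l t i (ip_u l t) = (s - t) * ip_b l (ip_u l s) 0 i.
Proof.
move=> lt ls; rewrite /Phi (ip_equation lt) (ip_equation ls) !mxE; ring.
Qed.

Let near_dom l t : ip_dom l t -> \forall s \near t, ip_dom l s.
Proof.
by move=> lt; apply: open_nbhs_nbhs; split => //; exact: ip_dom_open.
Qed.

(** [A - t * b] is expanding, and it takes the values [0] at [u t] and
    [(s - t) * b (u s)] at [u s]. *)
Lemma ip_lipschitz l t s : ip_dom l t -> ip_dom l s ->
  c * `|ip_u l s - ip_u l t| <= D%:R * (`|s - t| * B).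
Proof.
move=> lt ls.
apply: (@coercive_expanding _ _ Omega c (Phi l t) (dPhi l t)) => //.
- exact: ip_coercive.
- by move=> r r01; exact: ip_segment.
- move=> i; rewrite Phi_path// normrM ler_wpM2l//.
  by apply: (@ip_boundb l [::]) => //; exact: ip_in.
Qed.

Lemma ip_continuous l t : ip_dom l t -> {for t, continuous (ip_u l)}.
Proof.
move=> lt; apply: (@near_lipschitz_continuous _ _ _ _ _ (c^-1 * (D%:R * B))).
apply: filterS (near_dom lt) => s ls.
rewrite -(ler_pM2l c_gt0) mulrA mulVKf ?gt_eqF//.
by apply: le_trans (ip_lipschitz lt ls) _; rewrite [`|s - t| * B]mulrC mulrA.
Qed.

Let J l t : 'M[R]_D := \matrix_(i, j) dPhi l t i j (ip_u l t).

Let J_inv l t : ip_dom l t ->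
  J l t \in unitmx /\ forall i j, `|invmx (J l t) i j| <= c^-1.
Proof.
move=> lt; apply: coercive_invmx => // x.
apply: le_trans (ip_coercive lt (ip_in lt) x) _.
by under [leRHS]eq_bigr do under eq_bigr do rewrite mxE.
Qed.

(** With Hadamard's slopes [q] of [A - t * b] at [u t], the equation at
    [s = h + t] reads [sum_j (u s - u t)_j * q i j (u s) = h * b (u s)_i].
    Multiplied by the inverse of the limit [J] of the slopes, it gives the
    difference quotient of [u] up to a term [dq * (q - J)], which tends to [0]
    because the difference quotients [dq] are bounded by the Lipschitz estimate. *)
Lemma ip_derive l t k : ip_dom l t ->
  is_derive t 1 (fun s => ip_u l s 0 k)
    (\sum_i invmx (J l t) k i * ip_b l (ip_u l t) 0 i).
Proof.
move=> lt; have Out := ip_in lt; have uc := ip_continuous lt.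
have /choice[q qP] : forall i, exists q : 'I_D -> 'rV[R]_D -> R,
    [/\ forall j, {for ip_u l t, continuous (q j)},
        forall j, q j (ip_u l t) = dPhi l t i j (ip_u l t)
      & forall y, Phi l t i y - Phi l t i (ip_u l t) =
          \sum_j (y 0 j - ip_u l t 0 j) * q j y].
  by move=> i; apply: hadamard (C1_Phi l t i) Out.
have [uJ _] := J_inv lt.
pose dq (h : R) j := h^-1 * (ip_u l (h + t) 0 j - ip_u l t 0 j).
have E (h : R) : h != 0 -> ip_dom l (h + t) ->
  h^-1 * (ip_u l (h + t) 0 k - ip_u l t 0 k) =
  \sum_i invmx (J l t) k i * (ip_b l (ip_u l (h + t)) 0 i -
    \sum_j dq h j * (q i j (ip_u l (h + t)) - J l t i j)).
  move=> h0 lh.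
  have Ei i : ip_b l (ip_u l (h + t)) 0 i -
    \sum_j dq h j * (q i j (ip_u l (h + t)) - J l t i j) =
    \sum_j J l t i j * dq h j.
    have [_ _ qE] := qP i.
    have := qE (ip_u l (h + t)); rewrite Phi_path// addrK => qh.
    have -> : ip_b l (ip_u l (h + t)) 0 i =
        \sum_j dq h j * q i j (ip_u l (h + t)).
      apply: (mulfI h0); rewrite qh mulr_sumr; apply: eq_bigr => j _.
      by rewrite /dq !mulrA divff// mul1r.
    by rewrite -sumrB; apply: eq_bigr => j _; ring.
  under eq_bigr do rewrite Ei.
  have := mulVmx uJ; move/matrixP => VJ.
  transitivity (\sum_j (invmx (J l t) *m J l t) k j * dq h j).
    rewrite (bigD1 k)//= VJ mxE eqxx mul1r big1 ?addr0// => j jk.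
    by rewrite VJ mxE eq_sym (negbTE jk) mul0r.
  transitivity (\sum_j \sum_i invmx (J l t) k i * J l t i j * dq h j).
    by apply: eq_bigr => j _; rewrite mxE mulr_suml.
  rewrite exchange_big/=; apply: eq_bigr => i _.
  by rewrite mulr_sumr; apply: eq_bigr => j _; rewrite -mulrA.
have nh : \forall h \near (0 : R)^', h != 0 /\ ip_dom l (h + t).
  have nd : \forall h \near (0 : R)^', ip_dom l (h + t).
    by apply: (@cvg_shift_dnbhs R t); exact: near_dom.
  by near=> h; split; near: h; [exact: nbhs_dnbhs_neq|exact: nd].
have uh : ip_u l (h + t) @[h --> 0^'] --> ip_u l t.
  exact: (cvg_comp (fun h => h + t) (ip_u l) (@cvg_shift_dnbhs R t) uc).
have dqB j : \forall h \near 0^', `|dq h j| <= c^-1 * (D%:R * `|B|).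
  apply: filterS nh => h [h0 lh].
  rewrite /dq normrM normfV ler_pdivrMl ?normr_gt0//.
  have := ip_lipschitz lt lh; rewrite addrK => L.
  rewrite -(ler_pM2l c_gt0); apply: (@le_trans _ _ (c * `|ip_u l (h + t) - ip_u l t|)).
    rewrite ler_pM2l//.
    have := (rV_norm_leP _ (normr_ge0 _)).1 (lexx `|ip_u l (h + t) - ip_u l t|) j.
    by rewrite !mxE.
  apply: le_trans L _.
  have -> : c * (`|h| * (c^-1 * (D%:R * `|B|))) = D%:R * (`|h| * `|B|).
    by field; rewrite gt_eqF.
  by rewrite ler_wpM2l// ler_wpM2l// ler_norm.
have limj i j : dq h j * (q i j (ip_u l (h + t)) - J l t i j) @[h --> 0^'] --> (0 : R).
  apply: cvg_bounded0 (dqB j) _.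
  have [qc qE _] := qP i.
  have Jij : J l t i j = q i j (ip_u l t) by rewrite /J mxE qE.
  have H := cvgB (cvg_comp (fun h => ip_u l (h + t)) (q i j) uh (qc j))
    (cvg_cst (J l t i j)).
  by rewrite -Jij subrr in H; exact: H.
apply/is_derive_cvgP.
have lim : \sum_i invmx (J l t) k i * (ip_b l (ip_u l (h + t)) 0 i -
    \sum_j dq h j * (q i j (ip_u l (h + t)) - J l t i j)) @[h --> 0^'] -->
  \sum_i invmx (J l t) k i * ip_b l (ip_u l t) 0 i.
  apply: cvg_sum_ord => i; apply: cvgM; first exact: cvg_cst.
  rewrite -[X in _ --> X]subr0; apply: cvgB.
    have := (ip_smoothb l).2 [::] isT _ Out => bc.
    have H := cvg_comp (fun h => ip_u l (h + t)) (ip_b l) uh bc.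
    exact: (cvg_comp _ (fun M : 'rV[R]_D => M 0 i) H (@coord_continuous _ _ _ _ _ _)).
  have H := cvg_sum_ord (fun j => limj i j).
  by rewrite big1// in H; exact: H _.
have EE : {near 0^', (fun h => \sum_i invmx (J l t) k i * (ip_b l (ip_u l (h + t)) 0 i -
    \sum_j dq h j * (q i j (ip_u l (h + t)) - J l t i j))) =1
   (fun h : R => h^-1 * (ip_u l (h + t) 0 k - ip_u l t 0 k))}.
  by apply: filterS nh => h [h0 lh]; rewrite E.
exact: cvg_trans (near_eq_cvg EE) lim.
Unshelve. all: by end_near. Qed.

Let famA s i l t := pderiv s (ip_A l) (ip_u l t) 0 i.
Let famb s i l t := pderiv s (ip_b l) (ip_u l t) 0 i.
Let famI i j l t := invmx (J l t) i j.
Let famu i l t := \sum_j famI i j l t * famb [::] j l t.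
Let bsm r (f : implicit_path -> R -> R) := unif_smooth ip_dom r f.

Let derive_famA s i l t : (size s < K)%N -> ip_dom l t ->
  is_derive t 1 (famA s i l) (\sum_j famu j l t * famA (j :: s) i l t).
Proof.
move=> sK lt.
have := @is_derive_path _ _ _ _ _ (ip_u l) _ t Omega_open
  (C1_pderiv i (ip_smoothA l) sK) (ip_in lt) (fun j => ip_derive j lt).
exact.
Qed.

Let derive_famb s i l t : (size s < K)%N -> ip_dom l t ->
  is_derive t 1 (famb s i l) (\sum_j famu j l t * famb (j :: s) i l t).
Proof.
move=> sK lt.
have := @is_derive_path _ _ _ _ _ (ip_u l) _ t Omega_open
  (C1_pderiv i (ip_smoothb l) sK) (ip_in lt) (fun j => ip_derive j lt).
exact.
Qed.

Let dJ p q l t := \sum_j famu j l t * famA [:: j; q] p l t +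
  -1 * (t * (\sum_j famu j l t * famb [:: j; q] p l t) + famb [:: q] p l t).

Let derive_famI i j l t : (1 < K)%N -> ip_dom l t ->
  is_derive t 1 (famI i j l)
    (-1 * \sum_p \sum_q famI i p l t * dJ p q l t * famI q j l t).
Proof.
move=> K1 lt; rewrite mulN1r.
have -> : \sum_p \sum_q famI i p l t * dJ p q l t * famI q j l t =
   \sum_p \sum_q invmx (J l t) i p * (\matrix_(p, q) dJ p q l t) p q *
     invmx (J l t) q j.
  by apply: eq_bigr => p _; apply: eq_bigr => q _; rewrite [in RHS]mxE.
apply: (@is_derive_invmx _ _ (J l) (\matrix_(p, q) dJ p q l t) t c^-1).
  move=> p q; rewrite mxE.
  have -> : (fun s => J l s p q) = famA [:: q] p l - (fun s => s * famb [:: q] p l s).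
    by apply/funext => s; rewrite /J mxE.
  have DA := @derive_famA [:: q] p l t K1 lt.
  have Db := @derive_famb [:: q] p l t K1 lt.
  have := is_deriveB DA (is_deriveM (is_derive_id t 1) Db).
  congr (is_derive _ _ _ _).
  by rewrite /dJ mulN1r; congr (_ - (_ + _)); rewrite /GRing.scale/= mulr1.
by apply: filterS (near_dom lt) => s ls; exact: J_inv.
Qed.

Let famT_smooth r : bsm r (fun _ t => t).
Proof.
have b2 : exists C, forall l t, ip_dom l t -> `|t| <= C.
  by exists 2 => l t; exact: ip_dom_bounded.
case: r => [|r]; split => //.
exists (fun _ _ => 1); split; first exact: unif_smooth_cst.
by move=> l t _; exact: is_derive_id.
Qed.

(** Along a path, [u' = J^-1 b (u)]; hence the derivative of a partial
    derivative of [A] or [b] is a sum of products of partial derivatives of one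
    order more, of entries of [J^-1] and of values of [b], and the derivative of
    [J^-1] is [- J^-1 J' J^-1], where [J'] contains partial derivatives of order
    two.  So each derivative in the parameter costs one order of differentiation
    of [A] and [b], which is the induction on [r]. *)
Lemma ip_families_smooth r :
  [/\ forall s i, (0 < size s)%N -> (size s + r <= K)%N -> bsm r (famA s i),
      forall s i, (size s + r <= K)%N -> bsm r (famb s i)
    & (r < K)%N -> forall i j, bsm r (famI i j)].
Proof.
elim: r => [|r [IHA IHb IHI]].
  split.
  - move=> s i s0; rewrite addn0 => sK; split => //; exists B => l t lt.
    by apply: ip_boundA (ip_in lt) _; rewrite s0.
  - move=> s i; rewrite addn0 => sK; split => //; exists B => l t lt.
    exact: ip_boundb (ip_in lt) _.
  - by move=> _ i j; split => //; exists c^-1 => l t lt; have [_] := J_inv lt; apply.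
have bu i : (r < K)%N -> bsm r (famu i).
  move=> rK; apply: unif_smooth_sum => j; apply: unif_smoothM; first exact: IHI.
  by apply: IHb; rewrite add0n ltnW.
split.
- move=> s i s0 srK.
  have sK : (size s < K)%N by apply: leq_trans srK; rewrite addnS ltnS leq_addr.
  have rK : (r < K)%N by apply: leq_trans srK; rewrite leq_addl.
  split.
    exists B => l t lt; apply: ip_boundA (ip_in lt) _.
    by rewrite s0 ltnW.
  exists (fun l t => \sum_j famu j l t * famA (j :: s) i l t); split.
    apply: unif_smooth_sum => j; apply: unif_smoothM; first exact: bu.
    by apply: IHA => //; rewrite addSnnS.
  by move=> l t lt; exact: derive_famA.
- move=> s i srK.
  have sK : (size s < K)%N by apply: leq_trans srK; rewrite addnS ltnS leq_addr.
  have rK : (r < K)%N by apply: leq_trans srK; rewrite leq_addl.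
  split.
    exists B => l t lt; apply: ip_boundb (ip_in lt) _.
    by rewrite ltnW.
  exists (fun l t => \sum_j famu j l t * famb (j :: s) i l t); split.
    apply: unif_smooth_sum => j; apply: unif_smoothM; first exact: bu.
    by apply: IHb => //; rewrite addSnnS.
  by move=> l t lt; exact: derive_famb.
- move=> rK i j; split.
    by exists c^-1 => l t lt; have [_] := J_inv lt; apply.
  have rK' : (r < K)%N by exact: ltnW.
  exists (fun l t => -1 * \sum_p \sum_q famI i p l t * dJ p q l t * famI q j l t).
  split; last first.
    by move=> l t lt; apply: derive_famI => //; apply: leq_ltn_trans rK.
  apply: unif_smoothM; first exact: unif_smooth_cst.
  apply: unif_smooth_sum => p; apply: unif_smooth_sum => q.
  apply: unif_smoothM; last exact: IHI.
  apply: unif_smoothM; first exact: IHI.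
  apply: unif_smoothD.
    apply: unif_smooth_sum => k; apply: unif_smoothM; first exact: bu.
    exact: IHA.
  apply: unif_smoothM; first exact: unif_smooth_cst.
  apply: unif_smoothD; last exact: IHb.
  apply: unif_smoothM; first exact: famT_smooth.
  apply: unif_smooth_sum => k; apply: unif_smoothM; first exact: bu.
  exact: IHb.
Qed.

Lemma ip_derivatives k :
  exists F : nat -> implicit_path -> R -> R, exists C : R,
  [/\ F 0%N = (fun l t => ip_u l t 0 k),
      forall j, (j < K)%N -> forall l t, ip_dom l t ->
        is_derive t 1 (F j l) (F j.+1 l t)
    & forall l t, ip_dom l t -> `|F K l t| <= C].
Proof.
have bu : bsm K.-1 (famu k).
  have [_ Hb HI] := ip_families_smooth K.-1.
  apply: unif_smooth_sum => j; apply: unif_smoothM; first by apply: HI; rewrite prednK.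
  by apply: Hb; rewrite add0n leq_pred.
have [F [C [F0 FS FC]]] := unif_smooth_chain bu.
exists (fun j => if j is j'.+1 then F j' else fun l t => ip_u l t 0 k), C.
split => // [[|j] jK l t lt|].
- by rewrite F0; exact: ip_derive.
- by apply: FS => //; rewrite -ltnS prednK.
- by rewrite -(prednK K_gt0).
Qed.

End ImplicitPath.

(** * From the operator norm of the inverse to coercivity *)

Lemma enorm_sqr (R : realType) (n : nat) (v : 'rV[R]_n) :
  enorm v ^+ 2 = \sum_i v 0 i ^+ 2.
Proof. by rewrite sqr_sqrtr// sumr_ge0// => i _; exact: sqr_ge0. Qed.

Lemma enorm_ge0 (R : realType) (n : nat) (v : 'rV[R]_n) : 0 <= enorm v.
Proof. exact: sqrtr_ge0. Qed.

Lemma enorm_le_sum (R : realType) (n : nat) (v : 'rV[R]_n) :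
  enorm v <= \sum_i `|v 0 i|.
Proof.
have s0 : 0 <= \sum_i `|v 0 i| by apply: sumr_ge0.
rewrite -(@ler_pXn2r _ 2) ?nnegrE ?enorm_ge0// enorm_sqr expr2 mulr_suml.
apply: ler_sum => i _; rewrite -real_normK ?num_real// expr2 ler_wpM2l//.
by rewrite (bigD1 i)//= lerDl sumr_ge0.
Qed.

Lemma coord_le_enorm (R : realType) (n : nat) (v : 'rV[R]_n) i :
  `|v 0 i| <= enorm v.
Proof.
rewrite -(@ler_pXn2r _ 2) ?nnegrE ?enorm_ge0// enorm_sqr real_normK ?num_real//.
by rewrite (bigD1 i)//= lerDl sumr_ge0// => j _; exact: sqr_ge0.
Qed.

Lemma enormZ (R : realType) (n : nat) (a : R) (v : 'rV[R]_n) :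
  enorm (a *: v) = `|a| * enorm v.
Proof.
rewrite /enorm/l2norm; under eq_bigr do rewrite mxE exprMn.
by rewrite -mulr_sumr sqrtrM ?sqr_ge0// sqrtr_sqr.
Qed.

Lemma enorm0 (R : realType) (n : nat) : enorm (0 : 'rV[R]_n) = 0.
Proof. by rewrite -(scale0r 0) enormZ normr0 mul0r. Qed.

(** The form is nonnegative at [x + t * y]; the choice [t = - b / q], which
    minimizes it, gives the inequality. *)
Lemma posdef_CS (R : realType) (n : nat) (H : 'M[R]_n) (x y : 'rV[R]_n) :
  sym_posdef H ->
  ((x *m H *m y^T) 0 0) ^+ 2 <= (x *m H *m x^T) 0 0 * (y *m H *m y^T) 0 0.
Proof.
move=> [sH pH]; have [->|y0] := eqVneq y 0.
  by rewrite trmx0 !mulmx0 mxE expr0n/= mulr0.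
have qy := pH y y0; set q := (y *m H *m y^T) 0 0 in qy *.
set b := (x *m H *m y^T) 0 0; set a := (x *m H *m x^T) 0 0.
have yx : (y *m H *m x^T) 0 0 = b.
  have -> : y *m H *m x^T = (x *m H *m y^T)^T by rewrite !trmx_mul trmxK sH mulmxA.
  by rewrite mxE.
have E t : ((x + t *: y) *m H *m (x + t *: y)^T) 0 0 = a + t * b *+ 2 + t ^+ 2 * q.
  rewrite linearD/= linearZ/= !mulmxDl !mulmxDr -!scalemxAl -!scalemxAr.
  have D (A B : 'M[R]_1) : (A + B) 0 0 = A 0 0 + B 0 0 by rewrite mxE.
  have Z c (A : 'M[R]_1) : (c *: A) 0 0 = c * A 0 0 by rewrite mxE.
  rewrite !D !Z -/a -/b -/q yx; ring.
have ge0 (z : 'rV[R]_n) : 0 <= (z *m H *m z^T) 0 0.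
  have [->|z0] := eqVneq z 0; first by rewrite trmx0 !mulmx0 mxE.
  exact: ltW (pH z z0).
have := ge0 (x + (- b / q) *: y); rewrite E => h.
have q0 : q != 0 by rewrite gt_eqF.
have h' : 0 <= a - b ^+ 2 / q.
  by apply: le_trans h _; rewrite le_eqVlt; apply/orP; left; apply/eqP; field.
by move: h'; rewrite subr_ge0 ler_pdivrMr.
Qed.

Lemma sym_posdef1 (R : realType) (n : nat) : sym_posdef (1%:M : 'M[R]_n).
Proof.
split=> [|x x0]; first by rewrite trmx1.
rewrite mulmx1 mxE; under eq_bigr do rewrite mxE -expr2.
rewrite -enorm_sqr exprn_gt0// lt_neqAle enorm_ge0 andbT eq_sym.
apply: contra x0 => /eqP e0; apply/eqP/rowP => i; rewrite mxE.
by apply/eqP; rewrite -normr_le0 -e0 coord_le_enorm.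
Qed.

Lemma dot_le_enorm (R : realType) (n : nat) (x y : 'rV[R]_n) :
  (x *m y^T) 0 0 <= enorm x * enorm y.
Proof.
have qE (z : 'rV[R]_n) : (z *m 1%:M *m z^T) 0 0 = enorm z ^+ 2.
  by rewrite mulmx1 mxE enorm_sqr; apply: eq_bigr => i _; rewrite mxE -expr2.
have := posdef_CS x y (sym_posdef1 R n); rewrite !qE mulmx1 -exprMn => h.
apply: le_trans (ler_norm _) _.
rewrite -(@ler_pXn2r _ 2) ?nnegrE ?mulr_ge0 ?enorm_ge0//.
by rewrite real_normK ?num_real.
Qed.

Lemma enorm_mulmx_opnorm (R : realType) (n : nat) (A : 'M[R]_n) (x : 'rV[R]_n) :
  enorm (A *m x^T)^T <= opnorm A * enorm x.
Proof.
have [x0|x0] := eqVneq (enorm x) 0.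
  have -> : x = 0.
    by apply/rowP => i; rewrite mxE; apply/eqP; rewrite -normr_le0 -x0 coord_le_enorm.
  by rewrite trmx0 mulmx0 trmx0 !enorm0 mulr0.
have xp : 0 < enorm x by rewrite lt_neqAle eq_sym x0 enorm_ge0.
rewrite -ler_pdivrMr// mulrC.
have -> : (enorm x)^-1 * enorm (A *m x^T)^T =
    enorm (A *m ((enorm x)^-1 *: x)^T)^T.
  by rewrite linearZ/= -scalemxAr linearZ/= enormZ ger0_norm// invr_ge0 enorm_ge0.
apply: ub_le_sup.
  exists (\sum_i \sum_j `|A i j|) => _ [y /= y1 <-].
  apply: le_trans (enorm_le_sum _) _; apply: ler_sum => i _.
  rewrite mxE mxE; apply: le_trans (ler_norm_sum _ _ _) _.
  apply: ler_sum => j _; rewrite mxE normrM ler_piMr//.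
  exact: le_trans (coord_le_enorm _ _) y1.
exists ((enorm x)^-1 *: x) => //=.
by rewrite enormZ ger0_norm ?invr_ge0 ?enorm_ge0// mulVf.
Qed.

(** Let [z] be [H^-1 x].  Then [|x| ^ 2] is the product of [x] and [z] for the
    form of [H], so its square is at most [<x, H x> * <z, H z>], and
    [<z, H z> = <z, x> <= C * |x| ^ 2]. *)
Lemma posdef_coercive (R : realType) (n : nat) (H : 'M[R]_n) (C : R) :
  0 < C -> sym_posdef H -> opnorm (invmx H) <= C ->
  forall x : 'rV[R]_n,
    C^-1 * (\sum_i x 0 i ^+ 2) <= \sum_i \sum_j x 0 i * x 0 j * H i j.
Proof.
move=> C0 pH HC x.
have -> : \sum_i \sum_j x 0 i * x 0 j * H i j = (x *m H *m x^T) 0 0.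
  rewrite mxE exchange_big/=; apply: eq_bigr => j _; rewrite mxE mulr_suml.
  by apply: eq_bigr => i _; rewrite mxE; ring.
rewrite -enorm_sqr.
have [->|x0] := eqVneq x 0; first by rewrite enorm0 trmx0 !mulmx0 mxE expr0n mulr0.
have uH : H \in unitmx.
  rewrite -row_free_unit; apply/inj_row_free => v vH; apply/eqP/negP => /negP v0.
  by have := pH.2 v v0; rewrite vH mul0mx mxE ltxx.
pose z := (invmx H *m x^T)^T.
have xz : (x *m H *m z^T) 0 0 = enorm x ^+ 2.
  rewrite trmxK -mulmxA mulKVmx// mxE enorm_sqr.
  by apply: eq_bigr => i _; rewrite mxE expr2.
have zz : (z *m H *m z^T) 0 0 <= C * enorm x ^+ 2.
  rewrite trmxK -mulmxA mulKVmx//.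
  apply: le_trans (dot_le_enorm _ _) _.
  rewrite expr2 mulrA ler_wpM2r ?enorm_ge0//.
  apply: le_trans (enorm_mulmx_opnorm _ _) _.
  by rewrite ler_wpM2r ?enorm_ge0.
have := posdef_CS x z pH; rewrite xz => h.
have xp : 0 < enorm x ^+ 2.
  have := (sym_posdef1 R n).2 x x0; rewrite mulmx1 mxE.
  by under eq_bigr do rewrite mxE -expr2; rewrite -enorm_sqr.
rewrite ler_pdivrMl// -(ler_pM2r xp) -expr2 mulrAC mulrC.
by apply: le_trans h _; rewrite ler_wpM2l// ltW// pH.2.
Qed.

(** * Partial derivatives of the estimating equation *)

Lemma near_eq_continuous (T U : topologicalType) (f g : T -> U) (x : T) :
  {near x, f =1 g} -> {for x, continuous f} -> {for x, continuous g}.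
Proof.
move=> fg cf; suff : g @ x --> g x by [].
rewrite -(nbhs_singleton fg).
have gf : {near x, g =1 f} by apply: filterS fg => z ->.
exact: cvg_trans (near_eq_cvg fg) cf.
Qed.

Lemma pderiv_near_eq (R : realType) (m : nat) (V : normedModType R)
    (f g : 'rV[R]_m -> V) (x : 'rV[R]_m) (s : seq 'I_m) :
  {near x, f =1 g} -> {near x, pderiv s f =1 pderiv s g}.
Proof.
elim: s => [//|i s IH] /IH fg.
have := near_join fg; apply: filterS => z fgz /=.
exact: near_eq_derive fgz.
Qed.

Lemma pderiv_comb (R : realType) (m K : nat) (V : normedModType R)
    (Omega : set 'rV[R]_m) (f g : 'rV[R]_m -> V) (a : R) (s : seq 'I_m) :
  open Omega -> Cn_on K Omega f -> Cn_on K Omega g -> (size s <= K)%N ->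
  forall y, Omega y ->
    pderiv s (fun y => f y + a *: g y) y = pderiv s f y + a *: pderiv s g y.
Proof.
move=> oO cf cg; elim: s => [//|i s IH] sK y Oy /=.
have E : {near y, pderiv s (fun y => f y + a *: g y) =1
    pderiv s f + a *: pderiv s g}.
  apply: filterS (open_nbhs_nbhs (conj oO Oy)) => z Oz.
  exact: IH (ltnW sK) z Oz.
have df := cf.1 s i sK y Oy; have dg := cg.1 s i sK y Oy.
rewrite (near_eq_derive _ E) deriveD//; last exact: derivableZ.
by rewrite deriveZ.
Qed.

Lemma Cn_on_comb (R : realType) (m K : nat) (V : normedModType R)
    (Omega : set 'rV[R]_m) (f g : 'rV[R]_m -> V) (a : R) :
  open Omega -> Cn_on K Omega f -> Cn_on K Omega g ->
  Cn_on K Omega (fun y => f y + a *: g y).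
Proof.
move=> oO cf cg.
have E (s : seq 'I_m) : (size s <= K)%N -> forall y, Omega y ->
    {near y, pderiv s f + a *: pderiv s g =1 pderiv s (fun y => f y + a *: g y)}.
  move=> sK y Oy; apply: filterS (open_nbhs_nbhs (conj oO Oy)) => z Oz.
  by rewrite (pderiv_comb a oO cf cg sK Oz).
split=> [s i sK y Oy|s sK y Oy].
  apply: (near_eq_derivable (E s (ltnW sK) y Oy)).
  have df := cf.1 s i sK y Oy; have dg := cg.1 s i sK y Oy.
  by apply: derivableD => //; exact: derivableZ.
apply: near_eq_continuous (E s sK y Oy) _.
apply: continuousD; first exact: cf.2.
by apply: (@continuousZ _ _ _ (cst a) (pderiv s g)); [exact: cst_continuous|exact: cg.2].
Qed.

Lemma pderiv_cst0 (R : realType) (m : nat) (V : normedModType R) (s : seq 'I_m) :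
  pderiv s (fun=> 0 : V) = fun=> 0.
Proof. by elim: s => [//|i s /= ->]; apply/funext => x; exact: derive_cst. Qed.

Lemma Cn_on_cst0 (R : realType) (m K : nat) (V : normedModType R)
    (Omega : set 'rV[R]_m) : Cn_on K Omega (fun=> 0 : V).
Proof.
split=> [s i _ y _|s _ y _]; rewrite pderiv_cst0; first exact: derivable_cst.
exact: cst_continuous.
Qed.

Section EstG.
Context (R : realType) (D N K : nat) (Omega : set 'rV[R]_D).
Context (g : nat -> 'rV[R]_D -> 'rV[R]_D).
Context (Omega_open : open Omega).
Context (smooth : forall k, (k <= N)%N -> Cn_on K Omega (g k)).

Let part (w : 'rV[R]_N) (e : seq 'I_N) (theta : 'rV[R]_D) : 'rV[R]_D :=
  g 0%N theta + \sum_(n <- e) w 0 n *: g n.+1 theta.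

Let part_smooth w e : Cn_on K Omega (part w e) /\
  forall s, (size s <= K)%N -> forall y, Omega y ->
    pderiv s (part w e) y =
    pderiv s (g 0%N) y + \sum_(n <- e) w 0 n *: pderiv s (g n.+1) y.
Proof.
elim: e => [|n e [IHc IHd]].
  have -> : part w [::] = g 0%N.
    by apply/funext => y; rewrite /part big_nil addr0.
  by split=> [|s sK y Oy]; [exact: smooth|rewrite big_nil addr0].
have -> : part w (n :: e) = fun y => part w e y + w 0 n *: g n.+1 y.
  by apply/funext => y; rewrite /part big_cons -addrA [X in _ + X]addrC.
have gn : Cn_on K Omega (g n.+1) by exact: smooth.
split=> [|s sK y Oy]; first exact: Cn_on_comb.
rewrite (pderiv_comb _ Omega_open IHc gn sK Oy) IHd// big_cons -addrA.
by rewrite [X in _ + X]addrC.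
Qed.

Let estGE w : (fun theta => estG (N := N) g theta w) =
  fun theta => 0 + N%:R^-1 *: part w (index_enum _) theta.
Proof. by apply/funext => y; rewrite add0r. Qed.

Lemma estG_smooth w : Cn_on K Omega (fun theta => estG (N := N) g theta w).
Proof.
rewrite estGE; apply: Cn_on_comb => //; first exact: Cn_on_cst0.
exact: (part_smooth w _).1.
Qed.

Lemma pderiv_estG w s theta : (size s <= K)%N -> Omega theta ->
  pderiv s (fun theta => estG (N := N) g theta w) theta =
  N%:R^-1 *: (pderiv s (g 0%N) theta + \sum_n w 0 n *: pderiv s (g n.+1) theta).
Proof.
move=> sK Ot; have [pc pd] := part_smooth w (index_enum _).
rewrite estGE (pderiv_comb _ Omega_open (Cn_on_cst0 _ _ _) pc sK Ot) pderiv_cst0.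
by rewrite add0r pd.
Qed.

Lemma estG_diff (w w' : 'rV[R]_N) theta :
  estG g theta w' - estG g theta w =
  N%:R^-1 *: \sum_n (w' 0 n - w 0 n) *: g n.+1 theta.
Proof.
rewrite /estG -scalerBr; congr (_ *: _).
rewrite opprD addrACA subrr add0r -sumrB; apply: eq_bigr => n _.
by rewrite scalerBl.
Qed.

Lemma pderiv_estG_diff (w w' : 'rV[R]_N) s theta : (size s <= K)%N -> Omega theta ->
  pderiv s (fun theta => estG (N := N) g theta w') theta -
  pderiv s (fun theta => estG (N := N) g theta w) theta =
  N%:R^-1 *: \sum_n (w' 0 n - w 0 n) *: pderiv s (g n.+1) theta.
Proof.
move=> sK Ot; rewrite !pderiv_estG// -scalerBr; congr (_ *: _).
rewrite opprD addrACA subrr add0r -sumrB; apply: eq_bigr => n _.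
by rewrite scalerBl.
Qed.

End EstG.

(** * The solution branch near the all-ones weights *)

Lemma conv_hull_segment (R : realType) (D : nat) (A : set 'rV[R]_D)
    (x y : 'rV[R]_D) (r : R) :
  A x -> A y -> 0 <= r <= 1 -> conv_hull A (x + r *: (y - x)).
Proof.
move=> Ax Ay /andP[r0 r1] C [cC AC].
have := cC y x (Itv01 r0 r1); rewrite !inE => /(_ (AC _ Ay) (AC _ Ax)).
congr (C _); rewrite /conv/=.
rewrite scalerBr scalerBl scale1r; apply/rowP => i; rewrite !mxE; ring.
Qed.

Lemma average_bound (R : realType) (N D : nat) (a : 'I_N -> R)
    (v : 'I_N -> 'rV[R]_D) (e B : R) (i : 'I_D) : (0 < N)%N ->
  (forall k, `|a k| <= e) -> (forall k, `|v k 0 i| <= B) ->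
  `|(N%:R^-1 *: \sum_k a k *: v k) 0 i| <= e * B.
Proof.
move=> N0 ae vB; rewrite mxE normrM normfV (ger0_norm (ler0n _ N)).
rewrite ler_pdivrMl ?ltr0n// summxE; apply: le_trans (ler_norm_sum _ _ _) _.
rewrite mulr_natl -[X in _ *+ X](card_ord N) -sumr_const.
by apply: ler_sum => k _; rewrite mxE normrM ler_pM.
Qed.

Section Branch.
Context (R : realType) (D N K : nat) (Omega : set 'rV[R]_D).
Context (g : nat -> 'rV[R]_D -> 'rV[R]_D) (th : 'rV[R]_N -> 'rV[R]_D).
Context (w : 'rV[R]_N) (eps c B : R).
Context (Omega_open : open Omega) (N_gt0 : (0 < N)%N) (K_gt0 : (0 < K)%N).
Context (c_gt0 : 0 < c) (eps_gt0 : 0 < eps).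
Context (smooth : forall k, (k <= N)%N -> Cn_on K Omega (g k)).
Context (coercive1 : coercive_on Omega c (fun i j theta =>
  pderiv [:: j] (fun theta => estG g theta (ones R N)) theta 0 i)).
Context (sol : forall w', Omega_w eps w w' -> estG g (th w') w' = 0).
Context (nbh : exists2 e : R, 0 < e & forall c theta,
  conv_hull (th @` Omega_w eps w) c -> enorm (theta - c) < e -> Omega theta).
Context (bound : forall (k : 'I_N) (s : seq 'I_D), (size s <= 1)%N ->
  forall theta, Omega theta -> forall i, `|pderiv s (g k.+1) theta 0 i| <= B).

Let G (w' : 'rV[R]_N) theta := estG g theta w'.
Let dG (w' : 'rV[R]_N) i j theta := pderiv [:: j] (G w') theta 0 i.

Lemma solution_segment w1 w2 r : Omega_w eps w w1 -> Omega_w eps w w2 ->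
  0 <= r <= 1 -> Omega (th w1 + r *: (th w2 - th w1)).
Proof.
move=> h1 h2 r01; have [e e0 nb] := nbh.
apply: (nb (th w1 + r *: (th w2 - th w1))).
  by apply: conv_hull_segment => //; exact: imageP.
by rewrite subrr enorm0.
Qed.

Lemma solution_in w1 : Omega_w eps w w1 -> Omega (th w1).
Proof.
move=> h1; have := solution_segment h1 h1 (r := 0).
by rewrite scale0r addr0 lexx ler01; apply.
Qed.

Lemma C1_estG w' i : C1_on Omega (fun theta => G w' theta 0 i) (dG w' i).
Proof.
exact: (@C1_pderiv _ _ _ _ _ _ [::] i (estG_smooth Omega_open smooth w') K_gt0).
Qed.

Let good w' := Omega_w eps w w' /\ coercive_on Omega (c / 2) (dG w').

Let near_good : \forall w' \near ones R N, good w'.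
Proof.
have c2 : 0 < c / 2 / (D%:R * (`|B| + 1) + 1).
  by rewrite !divr_gt0// ltr_wpDl// mulr_ge0// addr_ge0.
have e2 : 0 < eps / (N%:R + 1) by rewrite divr_gt0// ltr_wpDl.
near=> w'; split.
  exists 0; split; first by rewrite lexx ler01.
  rewrite subr0 scale1r scale0r addr0.
  have wo : `|w' - ones R N| <= eps / (N%:R + 1).
    by near: w'; exact: (near_norm_le (ones R N) e2).
  apply: le_lt_trans (enorm_le_sum _) _.
  apply: (@le_lt_trans _ _ (N%:R * (eps / (N%:R + 1)))); last first.
    by rewrite mulrCA gtr_pMr// ltr_pdivrMr ?ltr_wpDl// mul1r ltrDl.
  rewrite mulr_natl -[X in _ *+ X](card_ord N) -sumr_const.
  apply: ler_sum => i _.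
  by apply: (rV_norm_leP _ _).1; first exact: ltW.
have wo : `|w' - ones R N| <= c / 2 / (D%:R * (`|B| + 1) + 1).
  by near: w'; exact: (near_norm_le (ones R N) c2).
apply: (@coercive_weaken _ _ _ (c - `|w' - ones R N| * B * D%:R)).
  have -> : c / 2 = c - c / 2 by field.
  rewrite lerD2l lerN2.
  move: wo; rewrite ler_pdivlMr ?ltr_wpDl ?mulr_ge0 ?addr_ge0//; apply: le_trans.
  rewrite -mulrA ler_wpM2l// [leLHS]mulrC (le_trans (_ : _ <= D%:R * (`|B| + 1)))//.
    by rewrite ler_wpM2l// (le_trans (ler_norm _))// lerDl.
  by rewrite lerDl.
apply: coercive_perturb coercive1 _ => y Oy i j.
have := pderiv_estG_diff Omega_open smooth (ones R N) w' (s := [:: j]) K_gt0 Oy.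
move=> /(congr1 (fun M : 'rV[R]_D => M 0 i)); rewrite /dG.
rewrite [X in X = _]mxE [X in _ + X = _]mxE => ->.
apply: average_bound => // k; last exact: bound.
by have := (rV_norm_leP _ (normr_ge0 _)).1 (lexx `|w' - ones R N|) k; rewrite 2!mxE.
Unshelve. all: by end_near. Qed.

(** Near [1_N] the equation is still coercive, with constant [c / 2].  The
    expanding map at one weight vector, evaluated at the solutions for two weight
    vectors, bounds their distance by the effect of the change of the weights. *)
Lemma solution_near_continuous :
  \forall w' \near ones R N, {for w', continuous th}.
Proof.
have := near_join near_good; apply: filterS => w2 nw2.
have [in2 c2] := nbhs_singleton nw2.
apply: (@near_lipschitz_continuous _ _ _ _ _ ((c / 2)^-1 * (D%:R * B))).
apply: filterS nw2 => w1 [in1 _].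
have ch0 : 0 < c / 2 by rewrite divr_gt0.
rewrite -(ler_pM2l ch0).
have -> : c / 2 * ((c / 2)^-1 * (D%:R * B) * `|w1 - w2|) =
    D%:R * (`|w1 - w2| * B) by field; rewrite gt_eqF.
apply: (@coercive_expanding _ _ Omega (c / 2)
   (fun i theta => G w2 theta 0 i) (dG w2)) => //.
- by move=> i; exact: C1_estG.
- by move=> s s01; exact: solution_segment.
- move=> i; rewrite /G (sol in2) [X in _ - X]mxE subr0.
  have := estG_diff g w1 w2 (th w1).
  rewrite (sol in1) subr0 => ->.
  apply: average_bound => // [k|k].
    rewrite distrC.
    by have := (rV_norm_leP _ (normr_ge0 _)).1 (lexx `|w1 - w2|) k; rewrite !mxE.
  by have := @bound k [::] isT _ (solution_in in1) i.
Qed.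

(** The solutions [th] form a branch, so that the selected branch is one.
    Both stay in a ball around [th 1_N] contained in [Omega], on which the equation
    for a nearby weight vector is expanding and so has a single solution. *)
Lemma local_solution_near : \forall w' \near ones R N,
  local_solution (estG g) (th (ones R N)) (ones R N) w' = th w'.
Proof.
set phi := local_solution _ _ _.
have [phi1 phiN] : solution_branch (estG g) (th (ones R N)) (ones R N) phi.
  apply: xgetPex; exists th; split => //.
  have := near_good; have := solution_near_continuous.
  by apply: filterS2 => w' tc [in' _]; split => //; exact: sol.
have [in1 _] := nbhs_singleton near_good.
have [r /= r0 rO] := (nbhs_ballP _ _).1
  (open_nbhs_nbhs (conj Omega_open (solution_in in1))).
have r2 : 0 < r / 2 by rewrite divr_gt0.
have [_ phic] := nbhs_singleton phiN.
have thc := nbhs_singleton solution_near_continuous.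
have nphi : \forall w' \near ones R N, `|th (ones R N) - phi w'| <= r / 2.
  have : phi w' @[w' --> ones R N] --> th (ones R N) by rewrite -phi1.
  by move=> /(@cvgrPdist_le _ _ _ _ (nbhs_filter (ones R N)))/(_ _ r2).
have nth : \forall w' \near ones R N, `|th (ones R N) - th w'| <= r / 2.
  have : th w' @[w' --> ones R N] --> th (ones R N) by exact: thc.
  by move=> /(@cvgrPdist_le _ _ _ _ (nbhs_filter (ones R N)))/(_ _ r2).
have ng := near_good.
near=> w'.
have [in' c'] : good w' by near: w'.
have [phi0 _] : estG g (phi w') w' = 0 /\ {for w', continuous phi} by near: w'.
have ball1 : `|th (ones R N) - phi w'| <= r / 2 by near: w'.
have ball2 : `|th (ones R N) - th w'| <= r / 2 by near: w'.
have ch0 : 0 < c / 2 by rewrite divr_gt0.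
have : c / 2 * `|th w' - phi w'| <= D%:R * 0.
  apply: (@coercive_expanding _ _ Omega (c / 2)
     (fun i theta => G w' theta 0 i) (dG w')) => //.
  - by move=> i; exact: C1_estG.
  - move=> s /andP[s0 s1]; apply: rO; rewrite -ball_normE/=.
    have -> : th (ones R N) - (phi w' + s *: (th w' - phi w')) =
      (1 - s) *: (th (ones R N) - phi w') + s *: (th (ones R N) - th w').
      by apply/rowP => i; rewrite !mxE; ring.
    apply: le_lt_trans (ler_normD _ _) _; rewrite !normrZ.
    rewrite (ger0_norm s0) ger0_norm ?subr_ge0//.
    apply: (@le_lt_trans _ _ ((1 - s) * (r / 2) + s * (r / 2))).
      by apply: lerD; rewrite ler_wpM2l// subr_ge0.
    by rewrite -mulrDl subrK mul1r ltr_pdivrMr// ltr_pMr// ltr1n.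
  - by move=> i; rewrite /G (sol in') phi0 subrr normr0.
rewrite mulr0 pmulr_rle0// normr_le0 subr_eq0 => /eqP ->//.
Unshelve. all: by end_near. Qed.

End Branch.

(** * Error of the infinitesimal jackknife for one observation *)

Lemma wlooE (R : realType) (N : nat) (n : 'I_N) :
  wloo R n = ones R N - delta_mx 0 n.
Proof.
by apply/rowP => j; rewrite !mxE eqxx/=; case: eqP => _; rewrite ?subrr ?subr0.
Qed.

(** The only nonzero coordinate of [w_(-n) - 1_N] is the [n]-th, so among the
    mixed derivatives only the pure one in direction [n] remains. *)
Lemma delta_w_wloo (R : realType) (D N k : nat) (phi : 'rV[R]_N -> 'rV[R]_D)
    (n : 'I_N) :
  delta_w phi k (wloo R n) = (-1) ^+ k *: pderiv (nseq k n) phi (ones R N).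
Proof.
rewrite /delta_w (bigD1 [tuple of nseq k n])//= [X in _ + X]big1 ?addr0.
  congr (_ *: _); rewrite big_nseq -[LHS]/(iter k _ _).
  elim: k => [//|k IH]; rewrite iterS IH exprS; congr (_ * _).
  by rewrite wlooE addrC addKr !mxE !eqxx.
move=> s; rewrite -val_eqE/= => sn.
have /hasP[m ms /= mn] : has (predC (pred1 n)) s.
  rewrite has_predC; apply: contra sn => /all_pred1P sE.
  by rewrite [X in X == _]sE size_tuple.
suff -> : \prod_(i <- s) (wloo R n - ones R N) 0 i = 0 by rewrite scale0r.
apply/eqP; rewrite prodf_seq_eq0; apply/hasP; exists m => //=.
by rewrite !mxE mn subrr.
Qed.

(** The neighborhood of the segment also contains a piece of its line beyond
    both ends, which provides an open domain for the solution path. *)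
Lemma line_in_Omega_w (R : realType) (N : nat) (n : 'I_N) (eps x : R) :
  0 < eps -> - Num.min eps 1 < x < 1 + Num.min eps 1 ->
  Omega_w eps (wloo R n) (ones R N - x *: delta_mx 0 n).
Proof.
move=> e0 /andP[x1 x2].
have m0 : 0 < Num.min eps 1 by rewrite lt_min e0 ltr01.
have em : Num.min eps 1 <= eps by rewrite ge_min lexx.
have E t : ones R N - x *: delta_mx 0 n - ((1 - t) *: ones R N + t *: wloo R n) =
    (t - x) *: delta_mx 0 n.
  rewrite wlooE; apply/rowP => i; rewrite !mxE; ring.
have eN : enorm (delta_mx 0 n : 'rV[R]_N) = 1.
  rewrite -[LHS]ger0_norm ?enorm_ge0// -sqrtr_sqr enorm_sqr (bigD1 n)//=.
  rewrite mxE !eqxx expr1n big1 ?addr0 ?sqrtr1// => j jn.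
  by rewrite mxE (negbTE jn) andbF expr0n.
have [x0|x0] := ltP x 0.
  exists 0; split; first by rewrite lexx ler01.
  rewrite E enormZ eN mulr1 sub0r gtr0_norm ?oppr_gt0//.
  by apply: lt_le_trans em; rewrite ltrNl.
have [x3|x3] := leP x 1.
  by exists x; rewrite x0 x3 E subrr scale0r enorm0.
exists 1; split; first by rewrite lexx ler01.
rewrite E enormZ eN mulr1 distrC gtr0_norm ?subr_gt0//.
by apply: lt_le_trans em; rewrite ltrBlDl.
Qed.

(** The path [t |-> th (1_N - N * t * e_n)] goes from [th 1_N] at [0] to
    [th w_(-n)] at [1 / N], and its derivatives at [0] are, up to the powers of
    [- N] of the parametrization, those that enter the infinitesimal jackknife.
    The bound [B'] is only used near [1_N] and does not enter [C]. *)
Lemma jackknife_error (R : realType) (D kIJ : nat) (Omega : set 'rV[R]_D)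
    (c B : R) : open Omega -> 0 < c -> exists C : R,
  forall (N : nat) (g : nat -> 'rV[R]_D -> 'rV[R]_D)
    (th : 'rV[R]_N -> 'rV[R]_D) (n : 'I_N) (eps B' : R),
  0 < eps -> 4 * D%:R * B <= c * N%:R ->
  (forall k, (k <= N)%N -> Cn_on kIJ.+1 Omega (g k)) ->
  (forall w', Omega_w eps (wloo R n) w' -> estG g (th w') w' = 0) ->
  (exists2 e : R, 0 < e & forall c theta,
     conv_hull (th @` Omega_w eps (wloo R n)) c -> enorm (theta - c) < e ->
     Omega theta) ->
  coercive_on Omega c (fun i j theta =>
    pderiv [:: j] (fun theta => estG g theta (ones R N)) theta 0 i) ->
  (forall (k : 'I_N) (s : seq 'I_D), (size s <= 1)%N ->
    forall theta, Omega theta -> forall i, `|pderiv s (g k.+1) theta 0 i| <= B') ->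
  (forall s : seq 'I_D, (0 < size s <= kIJ.+1)%N -> forall theta, Omega theta ->
    forall i, `|pderiv s (fun theta => estG g theta (ones R N)) theta 0 i| <= B) ->
  (forall s : seq 'I_D, (size s <= kIJ.+1)%N -> forall theta, Omega theta ->
    forall i, `|pderiv s (g n.+1) theta 0 i| <= B) ->
  enorm (theta_IJ (estG g) (th (ones R N)) kIJ (wloo R n) - th (wloo R n))
    <= C * N%:R ^- kIJ.+1.
Proof.
move=> oO c0; set K := kIJ.+1.
have c20 : 0 < c / 2 by rewrite divr_gt0.
have K0 : (0 < K)%N by [].
have /choice[FC FCP] : forall k : 'I_D, exists FC :
    (nat -> implicit_path K Omega (c / 2) B -> R -> R) * R,
  [/\ FC.1 0%N = (fun l t => ip_u l t 0 k),
      forall j, (j < K)%N -> forall l t, ip_dom l t ->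
        is_derive t 1 (FC.1 j l) (FC.1 j.+1 l t)
    & forall l t, ip_dom l t -> `|FC.1 K l t| <= FC.2].
  by move=> k; have [F [C H]] := ip_derivatives oO B c20 K0 k; exists (F, C).
exists (\sum_k `|(FC k).2|).
move=> N g th n eps B' e0 Nlarge smooth sol nbh coer1 bndall bndA bndb.
have N0 : (0 < N)%N by apply: leq_ltn_trans (ltn_ord n).
have NR : 0 < N%:R :> R by rewrite ltr0n.
have NRn : (N%:R : R) != 0 by rewrite gt_eqF.
(* A margin of at most [1] at both ends keeps [N * t] between [-1] and [2]. *)
pose del : R := Num.min eps 1.
have del0 : 0 < del by rewrite lt_min e0 ltr01.
have del1 : del <= 1 by rewrite ge_min lexx orbT.
pose dom : set R := [set` `](- del / N%:R), ((1 + del) / N%:R)[%R].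
have domE t : dom t <-> - del < N%:R * t < 1 + del.
  rewrite /dom/= in_itv/= ltr_pdivrMr// ltr_pdivlMr// [t * _]mulrC.
  by split.
pose W t : 'rV[R]_N := ones R N - (N%:R * t) *: delta_mx 0 n.
have WO t : dom t -> Omega_w eps (wloo R n) (W t).
  by move=> /domE td; apply: line_in_Omega_w.
have domB t : dom t -> `|t| <= 2 / N%:R.
  move=> /domE /andP[t1 t2]; rewrite ler_pdivlMr// -[X in _ * X]gtr0_norm// -normrM.
  rewrite ler_norml mulrC; apply/andP; split; apply/ltW.
    by apply: le_lt_trans t1; rewrite lerN2 (le_trans del1)// ler1n.
  by apply: lt_le_trans t2 _; rewrite -[leRHS]/(1 + 1) lerD2l.
have smoothA := estG_smooth oO smooth (ones R N).
have WG theta t : estG g theta (W t) - estG g theta (ones R N) = - t *: g n.+1 theta.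
  rewrite estG_diff (bigD1 n)//= [X in _ *: (_ + X)]big1 => [|k kn].
    rewrite addr0 scalerA; congr (_ *: _); rewrite !mxE !eqxx/=; field.
    by [].
  by rewrite !mxE (negbTE kn) andbF mulr0 subr0 subrr scale0r.
have [l [lu ld]] : exists l : implicit_path K Omega (c / 2) B,
    ip_u l = (fun t => th (W t)) /\ ip_dom l = dom.
  unshelve eexists (@ImplicitPath _ _ _ _ _ _ (fun theta => estG g theta (ones R N))
    (g n.+1) (fun t => th (W t)) dom _ _ smoothA _ bndA bndb _ _ _); last by [].
  - exact: interval_open.
  - move=> t /domB tN; apply: le_trans tN _.
    by rewrite ler_pdivrMr// ler_peMr// ler1n.
  - exact: smooth.
  - move=> t td.
    (* The perturbation [t * db], with [|t| <= 2 / N], costs at most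
       [2 * B * D / N], which is at most [c / 2] by the bound on [N]. *)
    apply: (@coercive_weaken _ _ _ (c - (2 / N%:R) * B * D%:R)).
      have -> : c / 2 = c - c / 2 by field.
      rewrite lerD2l lerN2.
      have -> : 2 / N%:R * B * D%:R = (4 * D%:R * B) / N%:R / 2 by field.
      by rewrite ler_wpM2r// ler_pdivrMr.
    apply: coercive_perturb coer1 _ => y Oy i j.
    rewrite addrAC subrr sub0r normrN normrM ler_pM//; first exact: domB.
    exact: bndb.
  - move=> t td; have := WG (th (W t)) t; rewrite (sol _ (WO _ td)) sub0r scaleNr.
    by move/eqP; rewrite eqr_opp => /eqP.
  - by move=> s t r sd td r01; apply: (solution_segment nbh) => //; exact: WO.
(* The point [1_N + r * e_n] is the point of the path with parameter [r * nu]. *)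
pose nu : R := - N%:R^-1.
have pd j : (j <= K)%N -> forall r, dom (r * nu) ->
    pderiv (nseq j n) th (ones R N + r *: delta_mx 0 n) =
    \row_k (nu ^+ j * (FC k).1 j l (r * nu)).
  elim: j => [_ r rd|j IH jK r rd].
    apply/rowP => k; rewrite [RHS]mxE expr0 mul1r; have [-> _ _] := FCP k.
    rewrite lu /W/=; congr ((th _) _ _); rewrite /nu mulrN mulrN scaleNr opprK.
    by rewrite mulrCA divff// mulr1.
  rewrite /= -(derive_line _ _ _ _).2.
  have dnu : is_derive r 1 (fun r : R => r * nu) nu.
    have := is_derive_affine 0 nu r; congr (is_derive _ _ _ _).
    by apply/funext => x; rewrite add0r.
  have nr : {near r, (fun r : R => pderiv (nseq j n) th (ones R N + r *: delta_mx 0 n)) =1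
      (fun r : R => \row_k (nu ^+ j * (FC k).1 j l (r * nu)))}.
    have rc : r' * nu @[r' --> r] --> r * nu := is_derive_continuous dnu.
    have nd : \forall r' \near r, dom (r' * nu).
      by apply: rc; apply: open_nbhs_nbhs; split => //; exact: interval_open.
    by apply: filterS nd => r' r'd; exact: IH (ltnW jK) r' r'd.
  rewrite (near_eq_derive _ nr).
  have dk k : is_derive r 1 (fun r : R => nu ^+ j * (FC k).1 j l (r * nu))
      (nu ^+ j.+1 * (FC k).1 j.+1 l (r * nu)).
    have [_ dF _] := FCP k.
    have d1 : is_derive (r * nu) 1 ((FC k).1 j l) ((FC k).1 j.+1 l (r * nu)).
      by apply: dF => //; rewrite ld.
    have := is_deriveZ (nu ^+ j) (@is_derive1_comp _ _ (fun r => r * nu) r _ _ d1 dnu).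
    by congr (is_derive _ _ _ _); rewrite /GRing.scale/= exprSr; ring.
  rewrite derive_mx; last first.
    apply/derivable_mxP => i k; rewrite [X in derivable X](_ : _ =
      (fun r : R => nu ^+ j * (FC k).1 j l (r * nu))).
      by have [] := dk k.
    by apply/funext => x; rewrite mxE.
  apply/rowP => k; rewrite !mxE; have [_ <-] := dk k.
  by congr ('D__ _ _); apply/funext => x; rewrite mxE.
have dom0 : dom 0 by apply/domE; rewrite mulr0 oppr_lt0 del0 addr_gt0.
have phiE k : pderiv (nseq k n) (local_solution (estG g) (th (ones R N)) (ones R N))
    (ones R N) = pderiv (nseq k n) th (ones R N).
  have H := local_solution_near oO N0 K0 c0 e0 smooth coer1 sol nbh bndall.
  exact: nbhs_singleton (pderiv_near_eq (nseq k n) H).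
have err k : `|(theta_IJ (estG g) (th (ones R N)) kIJ (wloo R n) -
    th (wloo R n)) 0 k| <= `|(FC k).2| * N%:R ^- K.
  have [F0 dF FB] := FCP k.
  have dom01 t : 0 <= t <= N%:R^-1 -> dom t.
    move=> /andP[t0 t1]; apply/domE; apply/andP; split.
      by apply: (@lt_le_trans _ _ 0); rewrite ?oppr_lt0// mulr_ge0.
    by rewrite mulrC; apply: (@le_lt_trans _ _ 1); rewrite ?ltrDl// -ler_pdivlMr// mul1r.
  have := @taylor_bound R K (fun j => (FC k).1 j l) N%:R^-1 `|(FC k).2| _ _ _.
  rewrite exprVn => T; rewrite -normrN.
  have -> : - (theta_IJ (estG g) (th (ones R N)) kIJ (wloo R n) -
      th (wloo R n)) 0 k =
    (FC k).1 0%N l N%:R^-1 - \sum_(j < K) (FC k).1 j l 0 * N%:R^-1 ^+ j / j`!%:R.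
    rewrite F0 mxE [X in - (_ + X)]mxE opprB; congr (_ - _).
      by rewrite lu /W divff// scale1r wlooE.
    rewrite mxE -(big_mkord xpredT
      (fun j => (FC k).1 j l 0 * N%:R^-1 ^+ j / j`!%:R)) big_ltn//; congr (_ + _).
      by rewrite F0 lu /W mulr0 scale0r subr0 expr0 fact0 divr1 mulr1.
    rewrite summxE; apply: eq_big_nat => j /andP[j1 jK].
    rewrite delta_w_wloo phiE; have := pd j (ltnW jK) 0.
    rewrite mul0r scale0r addr0 => /(_ dom0) ->; rewrite !mxE.
    have <- : (-1) ^+ j * nu ^+ j = N%:R^-1 ^+ j by rewrite -exprMn /nu mulN1r opprK.
    by ring.
  apply: T.
  - by rewrite invr_ge0 ltW.
  - by move=> j jK t t01; apply: dF => //; rewrite ld; exact: dom01.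
  - move=> t t01; apply: (@le_trans _ _ (FC k).2); last exact: ler_norm.
    by apply: FB; rewrite ld; exact: dom01.
apply: le_trans (enorm_le_sum _) _.
by rewrite mulr_suml; apply: ler_sum => k _; exact: err.
Qed.

(** * Measurability of derivatives of random functions *)

Section DerivativeMeasurable.
Context (R : realType) (D : nat) (Omega : set 'rV[R]_D) (A : Type).
Context (Omega_open : open Omega).

Let F := g_sigma_algebraType (cylinders (R := R) (A := A) Omega).

Lemma measurable_eval theta a : Omega theta ->
  measurable_fun [set: F] (fun f : F => (f : 'rV[R]_D -> A -> R) theta a).
Proof.
move=> Ot _ B mB; rewrite setTI; apply: sub_sigma_algebra.
by exists theta, a, B.
Qed.

Let slice (idx : 'I_D -> A) (f : 'rV[R]_D -> A -> R) : 'rV[R]_D -> 'rV[R]_D :=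
  fun theta => \row_j f theta (idx j).

(** By induction on the number of differentiations: a derivative is the limit
    of the difference quotients with steps [1 / (m + 1)], and the upper limit is a
    measurable operation that is defined for all functions and returns this limit
    for the differentiable ones. *)
Lemma measurable_pderiv (idx : 'I_D -> A) (K : nat) (s : seq 'I_D) theta j :
  (size s <= K)%N -> Omega theta ->
  exists Phi : F -> R, measurable_fun [set: F] Phi /\
    forall f : 'rV[R]_D -> A -> R, Cn_on K Omega (slice idx f) ->
      Phi f = pderiv s (slice idx f) theta 0 j.
Proof.
elim: s theta => [|i s IH] theta sK Ot.
  exists (fun f : F => (f : 'rV[R]_D -> A -> R) theta (idx j)).
  by split=> [|f _]; [exact: measurable_eval|rewrite /= mxE].
pose h (m : nat) : R := m.+1%:R^-1.
have hm : h m @[m --> \oo] --> (0 : R) by exact: cvg_harmonic.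
have hN : \forall m \near \oo, Omega (theta + h m *: delta_mx 0 i).
  have H : (theta + h m *: delta_mx 0 i) @[m --> \oo] --> theta.
    rewrite -[X in _ --> X]addr0 -(scale0r (delta_mx 0 i)).
    by apply: cvgD; [exact: cvg_cst|apply: cvgZ => //; exact: cvg_cst].
  exact: H (open_nbhs_nbhs (conj Omega_open Ot)).
have [m0 _ m0P] := hN.
have ins m : Omega (theta + h (m0 + m)%N *: delta_mx 0 i).
  by apply: m0P; rewrite /= leq_addr.
have [Phi0 [mPhi0 Phi0E]] := IH theta (ltnW sK) Ot.
have /choice[Phi PhiP] : forall m, exists Phi : F -> R, measurable_fun [set: F] Phi /\
    forall f : 'rV[R]_D -> A -> R, Cn_on K Omega (slice idx f) ->
      Phi f = pderiv s (slice idx f) (theta + h (m0 + m)%N *: delta_mx 0 i) 0 j.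
  by move=> m; exact: IH (ltnW sK) (ins m).
pose q m (f : F) : \bar R := ((h (m0 + m)%N)^-1 * (Phi m f - Phi0 f))%:E.
pose L : F -> \bar R := fun f => limn_esup (q ^~ f).
exists (fun f => fine (L f)); split.
  have ml : measurable_fun [set: F] L.
    apply: measurable_fun_limn_esup => m; apply/measurable_EFinP.
    apply: measurable_funM => //.
    by apply: measurable_funB => //; exact: (PhiP m).1.
  exact: (measurableT_comp (@fine_measurable R _ measurableT) ml).
move=> f cf; have df := (C1_pderiv j cf sK Ot i).1.
have lim : (h (m0 + m)%N)^-1 * (Phi m f - Phi0 f) @[m --> \oo] -->
    pderiv (i :: s) (slice idx f) theta 0 j.
  have [dd <-] := df.
  have H : forall m, (h (m0 + m)%N)^-1 * (Phi m f - Phi0 f) =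
    (h (m0 + m)%N)^-1 *: (((fun y => pderiv s (slice idx f) y 0 j) \o shift theta)
      (h (m0 + m)%N *: delta_mx 0 i) - pderiv s (slice idx f) theta 0 j).
    by move=> m; rewrite (PhiP m).2// Phi0E//= [theta + _]addrC.
  under eq_fun do rewrite H.
  apply: (cvg_comp (fun m => h (m0 + m)%N) (fun x => x^-1 *:
    (((fun y => pderiv s (slice idx f) y 0 j) \o shift theta)
      (x *: delta_mx 0 i) - pderiv s (slice idx f) theta 0 j)) _ dd).
  have hm' : h (m0 + m)%N @[m --> \oo] --> (0 : R).
    have := hm; rewrite -(cvg_shiftn m0 h).
    have -> // : (fun n => h (n + m0)%N) = (fun m => h (m0 + m)%N).
    by apply/funext => m; rewrite addnC.
  move=> P nP; suff : \forall m \near \oo, P (h (m0 + m)%N) by [].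
  have H' : \forall m \near \oo, h (m0 + m)%N != 0 -> P (h (m0 + m)%N) := hm' _ nP.
  by apply: filterS H' => m; apply; rewrite /h invr_eq0 pnatr_eq0.
have lim' : q m f @[m --> \oo] --> (pderiv (i :: s) (slice idx f) theta 0 j)%:E.
  by apply: cvg_EFin; [exact: nearW|exact: lim].
rewrite /L is_cvg_limn_esupE; last by apply/cvg_ex; eexists; exact: lim'.
by rewrite (cvg_lim _ lim').
Qed.

End DerivativeMeasurable.

Lemma measurable_exceed d (T : measurableType d) (R : realType) (Q : countType)
    (A : finType) (ok : Q -> Prop) (Phi : Q -> A -> T -> R) (m : R) :
  (forall q a, ok q -> measurable_fun [set: T] (Phi q a)) ->
  measurable [set x | exists q a, ok q /\ m < `|Phi q a x|].
Proof.
move=> mPhi.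
have -> : [set x | exists q a, ok q /\ m < `|Phi q a x|] =
    \bigcup_(p : Q * A) [set x | ok p.1 /\ m < `|Phi p.1 p.2 x|].
  apply/seteqP; split => [x [q [a h]]|x [[q a] _ h]]; first by exists (q, a).
  by exists q, a.
apply: countable_bigcupT_measurable => // -[q a] /=.
have [okq|nok] := pselect (ok q); last first.
  by rewrite (_ : [set _ | _] = set0)//; apply/seteqP; split => x [].
rewrite (_ : [set _ | _] = [set: T] `&` (fun x => `|Phi q a x|) @^-1` `]m, +oo[).
  have mn : measurable_fun [set: T] (fun x => `|Phi q a x|).
    by apply: measurableT_comp => //; exact: mPhi.
  by apply: mn => //; exact: measurable_itv.
by apply/seteqP; split => x /=; rewrite in_itv/= andbT; tauto.
Qed.

Definition rat_point (R : realType) (D : nat) (q : 'rV[rat]_D) : 'rV[R]_D :=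
  map_mx ratr q.

Lemma rat_point_dense (R : realType) (D : nat) (theta : 'rV[R]_D)
    (U : set 'rV[R]_D) : nbhs theta U -> exists q, U (rat_point R q).
Proof.
move=> /nbhs_ballP[e /= e0 eU].
have e2 : 0 < e / 2 by rewrite divr_gt0.
have /choice[q qP] : forall j : 'I_D, exists r : rat, `|theta 0 j - ratr r| <= e / 2.
  move=> j.
  have ne : ball (theta 0 j) (e / 2) !=set0 by exists (theta 0 j); exact: ballxx.
  have [r [rin [p _ pr]]] := dense_rat ne (ball_open _ _).
  exists p; move: rin; rewrite -pr -ball_normE/=; exact: ltW.
exists (\row_j q j); apply: eU; rewrite -ball_normE/=.
apply: (@le_lt_trans _ _ (e / 2)); last by rewrite ltr_pdivrMr// ltr_pMr// ltr1n.
by apply/rV_norm_leP => [|j]; [exact: ltW|rewrite !mxE].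
Qed.

(** A countable version of the condition that the supremum over [Omega] is
    larger than [m]; the two agree for functions continuous on the open set [Omega]. *)
Definition exceeds (R : realType) (D : nat) (Omega : set 'rV[R]_D) (A : Type)
    (m : R) (f : 'rV[R]_D -> A -> R) : Prop :=
  exists q a, Omega (rat_point R q) /\ m < `|f (rat_point R q) a|.

Lemma not_exceeds_bound (R : realType) (D : nat) (Omega : set 'rV[R]_D)
    (A : Type) (m : R) (f : 'rV[R]_D -> A -> R) theta a :
  open Omega -> Omega theta -> {for theta, continuous (f ^~ a)} ->
  ~ exceeds Omega m f -> `|f theta a| <= m.
Proof.
move=> oO Ot cf nf; rewrite leNgt; apply/negP => mf; apply: nf.
have nm : \forall y \near theta, m < `|f y a|.
  have cn : `|f y a| @[y --> theta] --> `|f theta a|.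
    exact: (continuous_comp cf (@norm_continuous _ _ _)).
  exact: (@cvgr_gt _ _ _ (nbhs_filter theta) _ _ cn).
have [q [Oq mq]] := rat_point_dense (filterI (open_nbhs_nbhs (conj oO Ot)) nm).
by exists q, a.
Qed.

Lemma exceeds_product_event (R : realType) (D : nat) (Omega : set 'rV[R]_D)
    (A : finType) (m : R) :
  product_events Omega (exceeds (A := A) Omega m).
Proof.
pose F := g_sigma_algebraType (cylinders (R := R) (A := A) Omega).
apply: (@measurable_exceed _ F R _ _ (fun q => Omega (rat_point R q))
  (fun q a f => f (rat_point R q) a)) => q a Oq.
exact: measurable_eval.
Qed.

Lemma random_function_cylinders (R : realType) d (T : measurableType d) (D : nat)
    (Omega : set 'rV[R]_D) (A : Type) (X : T -> 'rV[R]_D -> A -> R) :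
  (forall theta a, Omega theta -> measurable_fun [set: T] (fun x => X x theta a)) ->
  random_function Omega X.
Proof.
move=> mX; suff : product_events (A := A) Omega `<=` [set E | measurable (X @^-1` E)].
  by [].
apply: smallest_sub => [|_ [theta [a [B [Ot mB ->]]]]].
  split => [|E mE|E mE] /=; first by rewrite preimage_set0.
    by rewrite setTD preimage_setC; exact: measurableC.
  by rewrite preimage_bigcup; apply: bigcupT_measurable.
by have := mX theta a Ot measurableT B mB; rewrite setTI.
Qed.

Lemma random_function_eval (R : realType) d (T : measurableType d) (D : nat)
    (Omega : set 'rV[R]_D) (A : Type) (X : T -> 'rV[R]_D -> A -> R) theta a :
  random_function Omega X -> Omega theta ->
  measurable_fun [set: T] (fun x => X x theta a).
Proof.
move=> rX Ot _ B mB; rewrite setTI.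
apply: (rX [set f | B (f theta a)]); apply: sub_sigma_algebra.
by exists theta, a, B.
Qed.

(** * Derivatives at the chosen observations *)

Lemma measure_subadd_seq (R : realType) d (T : measurableType d)
    (P : {measure set T -> \bar R}) (I : Type) (r : seq I) (F : I -> set T) :
  (forall i, measurable (F i)) ->
  (P (\big[setU/set0]_(i <- r) F i) <= \sum_(i <- r) P (F i))%E.
Proof.
move=> mF; elim: r => [|i r IH]; first by rewrite !big_nil measure0.
rewrite !big_cons; apply: le_trans (measureU2 _ (mF i) _) _.
  by apply: bigsetU_measurable.
exact: leeD2l.
Qed.

Lemma sum_prob_values (R : realType) d (T : measurableType d)
    (P : probability T R) (F : finType) (Y : T -> F) :
  (forall S : set F, measurable (Y @^-1` S)) ->
  (\sum_(i : F) P (Y @^-1` [set i]) = 1)%E.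
Proof.
move=> mY.
have H (r : seq F) : uniq r -> P (\big[setU/set0]_(i <- r) (Y @^-1` [set i])) =
    (\sum_(i <- r) P (Y @^-1` [set i]))%E.
  elim: r => [|i r IH] /=; first by rewrite !big_nil measure0.
  move=> /andP[ir ur]; rewrite !big_cons -IH// measureU//.
    by apply: bigsetU_measurable => j _; exact: mY.
  apply/seteqP; split => // x [/= Yx]; rewrite -bigcup_seq => -[j /= jr Yj].
  by move: ir; rewrite -Yx Yj jr.
rewrite -H ?index_enum_uniq// -bigcup_seq -(@probability_setT _ _ _ P).
congr (P _); apply/seteqP; split => // x _.
by exists (Y x) => //=; rewrite mem_index_enum.
Qed.

Lemma measure_ae_eq (R : realType) d (T : measurableType d)
    (P : {measure set T -> \bar R}) (A B : set T) :
  measurable A -> measurable B -> {ae P, forall x, A x <-> B x} -> P A = P B.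
Proof.
suff H (A' B' : set T) : measurable A' -> measurable B' ->
    {ae P, forall x, A' x <-> B' x} -> (P A' <= P B')%E.
  move=> mA mB AB; apply/eqP; rewrite eq_le !H//.
  by apply: filterS AB => x [].
move=> mA mB [N [mN N0 AB]].
rewrite -[leRHS](measureU0 mB mN N0).
apply: le_measure; rewrite ?inE//; first exact: measurableU.
move=> x Ax; have [Nx|Nx] := pselect (N x); [by right|left].
by apply: contrapT => nB; apply: Nx; apply: AB => /= -[] /(_ Ax).
Qed.

Lemma sup_on_ub (R : realType) (U : Type) (A : set U) (f : U -> R) (M : R) :
  (sup_on A f <= M%:E)%E -> forall x, A x -> f x <= M.
Proof.
move=> fM x Ax; rewrite -lee_fin; apply: le_trans fM.
by apply: ereal_sup_ubound; exists x.
Qed.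

Lemma sup_on_lty (R : realType) (U : Type) (A : set U) (f : U -> R) :
  (sup_on A f < +oo)%E -> exists M : nat, forall x, A x -> f x <= M%:R.
Proof.
case E : (sup_on A f) => [r| |]// _.
- have [M rM] : exists M : nat, r <= M%:R.
    exists (Num.bound `|r|); apply: le_trans (ler_norm _) _.
    by rewrite ltW// archi_boundP.
  by exists M; apply: sup_on_ub; rewrite E lee_fin.
- by exists 0%N; apply: sup_on_ub; rewrite E leNye.
Qed.

Lemma le_linfnorm (R : realType) (I : finType) (f : I -> R) i :
  `|f i| <= linfnorm f.
Proof. exact: (le_bigmax _ (fun i => `|f i|) i). Qed.

Lemma le_l2norm (R : realType) (I : finType) (f : I -> R) i :
  `|f i| <= l2norm f.
Proof.
rewrite /l2norm -sqrtr_sqr ler_wsqrtr// (bigD1 i)//= lerDl sumr_ge0// => j _.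
exact: sqr_ge0.
Qed.

Section Tails.
Context (R : realType) (d : measure_display) (T : measurableType d).
Context (P : probability T R) (D K Nloo : nat) (Omega : set 'rV[R]_D).
Context (Omega_open : open Omega) (g : nat -> T -> 'rV[R]_D -> 'rV[R]_D).
Context (g0_random : random_function Omega (fun x theta i => g 0%N x theta 0 i)).
Context (g_iid : forall k : nat, (k <= K)%N ->
  iid_random_functions P Omega (fun n x => darray k (g n.+1 x))).
Context (gamma_finite : forall k n : nat, (k <= K)%N -> (1 <= n)%N ->
  \forall x \ae P,
    (sup_on Omega (fun theta => linfnorm (darray k (g n x) theta)) < +oo)%E).

Definition big_derivative (k n : nat) (m : R) : set T :=
  [set x | exceeds Omega m (darray k (g n.+1 x))].

Lemma measurable_big_derivative k n m : (k <= K)%N ->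
  measurable (big_derivative k n m).
Proof.
move=> kK; have [rg _ _] := g_iid kK.
have := rg n _ (@exceeds_product_event R D Omega (darray_index D k) m).
exact.
Qed.

Lemma big_derivative_iid k n m : (k <= K)%N ->
  P (big_derivative k n m) = P (big_derivative k 0 m).
Proof.
move=> kK; have [_ _ idg] := g_iid kK.
have := idg n 0%N _ (@exceeds_product_event R D Omega (darray_index D k) m).
exact.
Qed.

Lemma big_derivative_anti k n (m m' : R) : m <= m' ->
  big_derivative k n m' `<=` big_derivative k n m.
Proof.
move=> mm x [q [a [Oq mf]]]; exists q, a; split => //.
exact: le_lt_trans mf.
Qed.

(** The events decrease to an event on which the supremum is infinite. *)
Lemma big_derivative_tail k (e : R) : (k <= K)%N -> 0 < e ->
  exists M : nat, (P (big_derivative k 0 M%:R) <= e%:E)%E.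
Proof.
move=> kK e0; pose F (i : nat) := big_derivative k 0 i%:R.
have mF i : measurable (F i) by exact: measurable_big_derivative.
have mI : measurable (\bigcap_i F i) by exact: bigcapT_measurable.
have FI0 : P (\bigcap_i F i) = 0%E.
  apply/(negligibleP P mI).
  apply: negligibleS (gamma_finite kK (leqnn 1)) => x Fx /= /sup_on_lty[M MP].
  have [q [a [Oq]]] := Fx M I.
  by rewrite ltNge => /negP; apply; apply: le_trans (MP _ Oq); exact: le_linfnorm.
have nF : nonincreasing_seq F.
  by move=> i j ij; apply/subsetPset; apply: big_derivative_anti; rewrite ler_nat.
have F0 : (P (F 0%N) < +oo)%E.
  by apply: le_lt_trans (probability_le1 P (mF 0%N)) _; rewrite ltry.
have cF : P \o F @ \oo --> P (\bigcap_i F i) by exact: nonincreasing_cvg_mu.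
rewrite FI0 in cF.
have /cvgrPdist_le/(_ e e0)[M _ MP] : fine (P (F i)) @[i --> \oo] --> (0 : R).
  exact: fine_cvg.
exists M; have := MP M (leqnn M); rewrite /= sub0r normrN.
have fP : P (F M) \is a fin_num by exact: fin_num_measure.
by rewrite ger0_norm ?fine_ge0// -lee_fin fineK.
Qed.

Lemma joint_random N :
  random_function Omega (fun x theta (a : 'I_N.+1 * 'I_D) => g a.1 x theta 0 a.2).
Proof.
apply: random_function_cylinders => theta [[[|i] iN] j] Ot /=.
  exact: (random_function_eval j g0_random Ot).
have [rg _ _] := g_iid (leq0n K).
exact: (random_function_eval ([tuple], j) (rg i) Ot).
Qed.

(** For smooth functions, a large derivative of [g_n] is an event about the
    values of the functions, which is the kind of event that the independence of
    the index set refers to. *)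
Lemma big_derivative_joint N k (n : 'I_N) m : (k <= K)%N ->
  exists E, product_events Omega E /\ forall x,
    (forall i, (i <= N)%N -> Cn_on K Omega (g i x)) ->
    big_derivative k n m x <->
    E (fun theta (a : 'I_N.+1 * 'I_D) => g a.1 x theta 0 a.2).
Proof.
move=> kK; pose A := ('I_N.+1 * 'I_D)%type.
pose F := g_sigma_algebraType (cylinders (R := R) (A := A) Omega).
pose idx (j : 'I_D) : A := (lift ord0 n, j).
have /choice[Phi PhiP] : forall qa : 'rV[rat]_D * darray_index D k,
    exists Phi : F -> R, Omega (rat_point R qa.1) ->
    measurable_fun [set: F] Phi /\ forall f : 'rV[R]_D -> A -> R,
      Cn_on K Omega (fun theta => \row_j f theta (idx j)) ->
      Phi f = pderiv qa.2.1 (fun theta => \row_j f theta (idx j))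
                (rat_point R qa.1) 0 qa.2.2.
  move=> [q [s j]] /=; have [Oq|nq] := pselect (Omega (rat_point R q)).
    have sK : (size s <= K)%N by rewrite size_tuple.
    by have [Phi PhiP] := measurable_pderiv Omega_open idx j sK Oq; exists Phi.
  by exists (fun=> 0).
exists [set f | exists q a, Omega (rat_point R q) /\ m < `|Phi (q, a) f|]; split.
  apply: (@measurable_exceed _ F R _ _ (fun q => Omega (rat_point R q))
    (fun q a f => Phi (q, a) f)) => q a Oq.
  exact: (PhiP (q, a) Oq).1.
move=> x sx; pose X (theta : 'rV[R]_D) (a : A) : R := g a.1 x theta 0 a.2.
have XE : (fun theta => \row_j X theta (idx j)) = g n.+1 x.
  by apply/funext => theta; apply/rowP => j; rewrite mxE.
have PE q a : Omega (rat_point R q) ->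
    Phi (q, a) X = darray k (g n.+1 x) (rat_point R q) a.
  by move=> Oq; rewrite (PhiP (q, a) Oq).2 XE//; exact: sx.
split=> -[q [a [Oq h]]]; exists q, a; split => //.
  by rewrite PE.
by rewrite -PE.
Qed.

Context (Nset : forall N : nat, T -> {set 'I_N}).
Context (Nloo_gt0 : (0 < Nloo)%N).
Context (Nset_card : forall N, (Nloo <= N)%N -> forall x, #|Nset N x| = Nloo).
Context (Nset_measurable : forall N (S : set {set 'I_N}),
  measurable (Nset N @^-1` S)).
Context (Nset_indep : forall N, (Nloo <= N)%N ->
  indep_of_random_function P Omega (Nset N)
    (fun x theta (a : 'I_N.+1 * 'I_D) => g a.1 x theta 0 a.2)).
Context (smooth : forall N, (Nloo <= N)%N -> \forall x \ae P,
  forall n : nat, (n <= N)%N -> Cn_on K Omega (g n x)).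

Let pairs N (S : {set 'I_N}) : seq ('I_N * 'I_K.+1) :=
  enum (finset.setX S [set: 'I_K.+1]).

Let union N m (S : {set 'I_N}) : set T :=
  \big[setU/set0]_(p <- pairs S) big_derivative p.2 p.1 m.

Let measurable_union N m (S : {set 'I_N}) : measurable (union m S).
Proof.
apply: bigsetU_measurable => p _; apply: measurable_big_derivative.
by rewrite -ltnS.
Qed.

Let union_indep N m (S : {set 'I_N}) : (Nloo <= N)%N ->
  P (Nset N @^-1` [set S] `&` union m S) =
  (P (Nset N @^-1` [set S]) * P (union m S))%E.
Proof.
move=> NN.
have /choice[E EP] : forall p : 'I_N * 'I_K.+1, exists E,
    product_events Omega E /\ forall x,
    (forall i, (i <= N)%N -> Cn_on K Omega (g i x)) ->
    big_derivative p.2 p.1 m x <->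
    E (fun theta (a : 'I_N.+1 * 'I_D) => g a.1 x theta 0 a.2).
  by move=> p; apply: big_derivative_joint; rewrite -ltnS.
set X := fun x theta (a : 'I_N.+1 * 'I_D) => g a.1 x theta 0 a.2.
pose EU := \big[setU/set0]_(p <- pairs S) E p.
have pE : product_events Omega EU.
  apply: (@bigsetU_measurable _ (g_sigma_algebraType
    (cylinders (R := R) (A := 'I_N.+1 * 'I_D) Omega))) => p _.
  exact: (EP p).1.
have mX : measurable (X @^-1` EU) by exact: joint_random.
have UE : {ae P, forall x, union m S x <-> (X @^-1` EU) x}.
  apply: filterS (smooth NN) => x sx.
  rewrite /union /EU /= -!bigcup_seq; split=> -[p /= ps] h; exists p => //.
    exact: ((EP p).2 x sx).1 h.
  exact: ((EP p).2 x sx).2 h.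
rewrite (measure_ae_eq (measurable_union m S) mX UE) -Nset_indep//.
apply: measure_ae_eq.
- by apply: measurableI => //; exact: Nset_measurable.
- by apply: measurableI => //; exact: Nset_measurable.
- by apply: filterS UE => x [h1 h2]; split=> -[? /=]; split => //; [exact: h1|exact: h2].
Qed.

(** Given the value [S] of the index set, a bad event is a union of
    [Nloo * (K + 1)] events, one for each index in [S] and each order.  By
    independence its probability is not affected by the conditioning, and by
    identical distribution each event is as likely as for the first observation.
    So [Gamma] is chosen from the first observation alone, whatever [N]. *)
Lemma derivatives_bounded_whp (eta : R) : 0 < eta -> exists Gamma : R,
  forall N, (Nloo <= N)%N -> exists B : set T,
  [/\ measurable B, (P B <= eta%:E)%E & forall x, ~ B x ->
    (forall n, (n <= N)%N -> Cn_on K Omega (g n x)) ->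
    forall n : 'I_N, n \in Nset N x ->
    forall s : seq 'I_D, (size s <= K)%N -> forall theta, Omega theta ->
    forall i, `|pderiv s (g n.+1 x) theta 0 i| <= Gamma].
Proof.
move=> eta0; pose e := eta / (Nloo * K.+1)%:R.
have c0 : 0 < (Nloo * K.+1)%:R :> R by rewrite ltr0n muln_gt0 Nloo_gt0.
have e0 : 0 < e by rewrite divr_gt0.
have /choice[M MP] : forall k : 'I_K.+1, exists M : nat,
    (P (big_derivative k 0 M%:R) <= e%:E)%E.
  by move=> k; apply: big_derivative_tail => //; rewrite -ltnS.
pose m : R := (\sum_k M k)%:R.
have mP (k : 'I_K.+1) n : (P (big_derivative k n m) <= e%:E)%E.
  have kK : (k <= K)%N by rewrite -ltnS.
  rewrite big_derivative_iid//; apply: le_trans (MP k).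
  apply: le_measure; rewrite ?inE; [exact: measurable_big_derivative..|].
  by apply: big_derivative_anti; rewrite ler_nat (bigD1 k)//= leq_addr.
exists m => N NN.
have Unbd (S : {set 'I_N}) : #|S| = Nloo -> (P (union m S) <= eta%:E)%E.
  move=> SN; apply: le_trans (measure_subadd_seq _ _ _) _.
    by move=> p; apply: measurable_big_derivative; rewrite -ltnS.
  apply: (@le_trans _ _ (\sum_(p <- pairs S) e%:E)%E).
    by apply: lee_sum => p _; exact: mP.
  rewrite sumEFin lee_fin big_enum/= sumr_const cardsX cardsT card_ord SN.
  by rewrite -mulr_natr /e divfK// gt_eqF.
exists (\big[setU/set0]_(S : {set 'I_N}) (Nset N @^-1` [set S] `&` union m S)); split.
- by apply: bigsetU_measurable => S _; apply: measurableI => //; exact: Nset_measurable.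
- apply: le_trans (measure_subadd_seq _ _ _) _.
    by move=> S; apply: measurableI => //; exact: Nset_measurable.
  apply: (@le_trans _ _ (\sum_(S : {set 'I_N}) (eta%:E * P (Nset N @^-1` [set S])))%E).
    apply: lee_sum => S _; rewrite /= (union_indep m S NN) muleC.
    have [/Unbd US|SN] := eqVneq #|S| Nloo; first exact: lee_wpmul2r.
    rewrite (_ : _ @^-1` _ = set0) ?measure0 ?mule0//.
    apply/seteqP; split => // x /= NS.
    by move: SN; rewrite -NS Nset_card// eqxx.
  rewrite -ge0_sume_distrr// sum_prob_values ?mule1//.
  exact: Nset_measurable.
- move=> x nB sx n nS s sK theta Ot i.
  have nE : ~ exceeds Omega m (darray (size s) (g n.+1 x)).
    move=> ex; apply: nB; rewrite -bigcup_seq; exists (Nset N x) => /=.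
      exact: mem_index_enum.
    split => //; rewrite /union -bigcup_seq.
    exists (n, Ordinal (sK : (size s < K.+1)%N)) => //=.
    by rewrite mem_enum finset.in_setX nS finset.in_setT.
  have := @not_exceeds_bound _ _ _ _ _ _ theta (in_tuple s, i) Omega_open Ot _ nE.
  apply.
  have gC : {for theta, continuous (pderiv s (g n.+1 x))}.
    by apply: (sx n.+1 (ltn_ord n)).2.
  exact: (@continuous_comp _ _ _ (pderiv s (g n.+1 x)) (fun v : 'rV[R]_D => v 0 i) theta
    gC (@coord_continuous _ _ _ _ _ _)).
Qed.

End Tails.

(** * Accuracy of the infinitesimal jackknife *)

Theorem proposition2
  (R : realType) (d : measure_display) (T : measurableType d)
  (P : probability T R) (D kIJ Nloo : nat)
  (Omega : set 'rV[R]_D) (Omega_open : open Omega)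
  (* g n x theta : the function g_n at the outcome x *)
  (g : nat -> T -> 'rV[R]_D -> 'rV[R]_D)
  (g0_random : random_function Omega (fun x theta i => g 0%N x theta 0 i))
  (g_iid : forall k : nat, (k <= kIJ.+1)%N ->
     iid_random_functions P Omega (fun n x => darray k (g n.+1 x)))
  (g_moment : forall k n : nat, (k <= kIJ.+1)%N -> (1 <= n)%N ->
     forall theta, Omega theta ->
       ('E_P[fun x => (l2norm (darray k (g n x) theta) ^+ 2)%R] < +oo)%E)
  (gamma_finite : forall k n : nat, (k <= kIJ.+1)%N -> (1 <= n)%N ->
     \forall x \ae P,
       (sup_on Omega (fun theta => linfnorm (darray k (g n x) theta)) < +oo)%E)
  (Nloo_gt0 : (0 < Nloo)%N)
  (Nset : forall N : nat, T -> {set 'I_N})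
  (Nset_card : forall N, (Nloo <= N)%N -> forall x, #|Nset N x| = Nloo)
  (Nset_measurable : forall N (S : set {set 'I_N}), measurable (Nset N @^-1` S))
  (Nset_indep : forall N, (Nloo <= N)%N ->
     indep_of_random_function P Omega (Nset N)
       (fun x theta (a : 'I_N.+1 * 'I_D) => g a.1 x theta 0 a.2))
  (eps : nat -> R) (eps_gt0 : forall N, 0 < eps N)
  (thetahat : forall N : nat, T -> 'rV[R]_N -> 'rV[R]_D)
  (solution : forall N, (Nloo <= N)%N -> \forall x \ae P,
     forall w, w \in Wloo R (Nset N x) ->
       (forall w', Omega_w (eps N) w w' ->
          estG (fun n => g n x) (thetahat N x w') w' = 0) /\
       (exists2 e : R, 0 < e &
          forall c theta,
            conv_hull (thetahat N x @` Omega_w (eps N) w) c ->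
            enorm (theta - c) < e -> Omega theta))
  (smooth : forall N, (Nloo <= N)%N -> \forall x \ae P,
     forall n : nat, (n <= N)%N -> Cn_on kIJ.+1 Omega (g n x))
  (Cop : R)
  (strongly_convex : forall N, (Nloo <= N)%N -> \forall x \ae P,
     let H theta := hessian (estG (N := N) (fun n => g n x)) theta (ones R N) in
     (forall theta, Omega theta -> sym_posdef (H theta)) /\
     (sup_on Omega (fun theta => opnorm (invmx (H theta))) <= Cop%:E)%E)
  (M : nat -> R)
  (bounded : forall N, (Nloo <= N)%N -> \forall x \ae P,
     forall k : nat, (1 <= k <= kIJ.+1)%N ->
       (sup_on Omega (fun theta => l2norm
          (darray k (fun th => estG (fun n => g n x) th (ones R N)) theta))
        <= (M k)%:E)%E) :
  forall eta : R, 0 < eta ->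
  exists C : R, exists N0 : nat, forall N : nat, (N0 <= N)%N ->
    with_prob_ge P (1 - eta)
      [set x | \big[Num.max/0]_(w <- Wloo R (Nset N x))
                 enorm (theta_IJ (estG (fun n => g n x))
                          (thetahat N x (ones R N)) kIJ w
                        - thetahat N x w)
               <= C * N%:R ^- kIJ.+1].
Proof.
move=> eta eta0; set K := kIJ.+1.
have [Gamma GammaP] := derivatives_bounded_whp Omega_open g0_random g_iid
  gamma_finite Nloo_gt0 Nset_card Nset_measurable Nset_indep smooth eta0.
(* For [D = 0] the hypotheses allow [Cop] to be nonpositive. *)
pose c := (Num.max Cop 1)^-1.
have Cop1 : 0 < Num.max Cop 1 by rewrite lt_max ltr01 orbT.
have c0 : 0 < c by rewrite invr_gt0.
pose B := Num.max Gamma (\sum_(k < K.+1) `|M k|).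
have [C CP] := jackknife_error kIJ B Omega_open c0.
exists (Num.max C 0), (maxn Nloo (Num.bound `|4 * D%:R * B / c|)).
move=> N; rewrite geq_max => /andP[NN Nlarge].
have Nlarge' : 4 * D%:R * B <= c * N%:R.
  rewrite [leRHS]mulrC -ler_pdivrMr// (le_trans (ler_norm _))//.
  by rewrite (le_trans (ltW (archi_boundP (normr_ge0 _))))// ler_nat.
have [E [mE PE EP]] := GammaP N NN.
have gammaN : \forall x \ae P, forall k n : nat, (k <= K)%N -> (1 <= n)%N ->
    (sup_on Omega (fun theta => linfnorm (darray k (g n x) theta)) < +oo)%E.
  apply: ae_foralln => k; apply: ae_foralln => n.
  have [kK|kK] := boolP (k <= K)%N; last by apply: nearW.
  have [n1|n1] := boolP (1 <= n)%N; last by apply: nearW.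
  by apply: filterS (gamma_finite k n kK n1).
have [N0 [mN0 PN0 N0P]] := filterI (filterI (solution N NN) (smooth N NN))
  (filterI (filterI (strongly_convex N NN) (bounded N NN)) gammaN).
exists (~` (E `|` N0)); split.
- by apply: measurableC; exact: measurableU.
- move=> x /= /not_orP[nE nN0].
  have := contrapT (fun H => nN0 (N0P x H)).
  move=> [[solx smoothx] [[convx boundx] gammax]].
  have NR0 : 0 <= N%:R ^- K :> R by rewrite invr_ge0 exprn_ge0.
  rewrite /Wloo big_map big_enum/=; apply: bigmax_le => [|n nS].
    by rewrite mulr_ge0// le_max lexx orbT.
  have nW : wloo R n \in Wloo R (Nset N x) by apply: map_f; rewrite mem_enum.
  have [soln nbhn] := solx _ nW.
  have [B' B'P] : exists B' : R, forall (k : 'I_N) (s : seq 'I_D), (size s <= 1)%N ->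
      forall theta, Omega theta -> forall i, `|pderiv s (g k.+1 x) theta 0 i| <= B'.
    have /choice[b bP] : forall kj : 'I_N * 'I_2, exists b : nat,
        forall theta, Omega theta ->
          linfnorm (darray kj.2 (g kj.1.+1 x) theta) <= b%:R.
      move=> [k j] /=; apply: sup_on_lty; apply: gammax => //.
      by apply: (@leq_trans 1); rewrite // -ltnS.
    exists (\sum_kj b kj)%:R => k s s1 theta Ot i.
    apply: (@le_trans _ _ (b (k, Ordinal (s1 : (size s < 2)%N)))%:R).
      apply: le_trans (bP (k, Ordinal (s1 : (size s < 2)%N)) theta Ot).
      exact: (le_linfnorm (darray (size s) (g k.+1 x) theta) (in_tuple s, i)).
    by rewrite ler_nat (bigD1 (k, Ordinal (s1 : (size s < 2)%N)))//= leq_addr.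
  apply: (@le_trans _ _ (C * N%:R ^- K)); last first.
    by rewrite ler_wpM2r// le_max lexx.
  apply: (CP N (fun n => g n x) (thetahat N x) n (eps N) B') => //.
  + move=> y Oy v; have [pdH opH] := convx.
    have opy : opnorm (invmx (hessian (estG (fun n => g n x)) y (ones R N))) <=
        Num.max Cop 1.
      by rewrite (le_trans (sup_on_ub opH Oy))// le_max lexx.
    apply: le_trans (posdef_coercive Cop1 (pdH y Oy) opy v) _.
    by under eq_bigr do under eq_bigr do rewrite mxE.
  + move=> s sK theta Ot i; have /andP[s0 sK'] := sK.
    apply: le_trans (le_l2norm (darray (size s)
      (fun th => estG (fun n => g n x) th (ones R N)) theta) (in_tuple s, i)) _.
    apply: le_trans (sup_on_ub (boundx (size s) sK) Ot) _.
    rewrite le_max; apply/orP; right; apply: le_trans (ler_norm _) _.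
    by rewrite (bigD1 (Ordinal (sK' : (size s < K.+1)%N)))//= lerDl sumr_ge0.
  + move=> s sK theta Ot i.
    by rewrite (le_trans (EP x nE smoothx n nS s sK theta Ot i))// le_max lexx.
- rewrite probability_setC; last exact: measurableU.
  by rewrite measureU0// EFinB leeB.
Qed.
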